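(* Let $T$ be a continuous first order theory and $\mathfrak p$ a perturbation system for $T$. Then any two elementarily equivalent separable $\mathfrak p$-approximately $\aleph_0$-saturated models of $T$ are $\mathfrak p$-isomorphic.
   Context: We work in continuous first order logic; structures are bounded complete metric structures with metric $d$. $S_n(T)$ is the compact Hausdorff space of complete $n$-types of $T$ (logic topology), and $S_n(\bar a)$ the space of complete $n$-types over $\bar a$. The metric on finite tuples is the supremum metric. Perturbation pre-radii. A perturbation pre-radius $\rho$ for $T$ is a family of closed sets $\rho_n \subseteq S_n(T)^2$ ($n\in\mathbb N$), each containing the diagonal. For $X \subseteq S_n(T)$, $X^\rho = \{q : (\exists p \in X)\,(p,q) \in \rho_n\}$, and $p^\rho=\{p\}^\rho$. For $M,N \models T$, a $\rho$-perturbation from $M$ into $N$ is a map $f\colon M \to N$ such that $\mathrm{tp}^N(f(\bar a)) \in \mathrm{tp}^M(\bar a)^\rho$ for every finite tuple $\bar a\in M$; $\mathrm{Pert}_\rho(M,N)$ is the set of these. $\mathrm{BiPert}_\rho(M,N)$ is the set of bijective $f\in\mathrm{Pert}_\rho(M,N)$ with $f^{-1}\in\mathrm{Pert}_\rho(N,M)$. A perturbation radius is a pre-radius $\rho$ such that for every $n$ and $(p,q)\in\rho_n$ there are $M,N\models T$ and a $\rho$-perturbation $f\colon M\to N$ sending some realisation of $p$ to a realisation of $q$. $\rho$ is symmetric if each $\rho_n$ is a symmetric relation. $\rho\le\rho'$ means $\rho_n\subseteq\rho'_n$ for all $n$. Composition: $(\rho'\circ\rho)_n=\{(p,q):\exists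 r\,(p,r)\in\rho_n,\ (r,q)\in\rho'_n\}$. $\mathrm{id}$ is the pre-radius consisting of the diagonals. A perturbation system $\mathfrak p$ for $T$ assigns to each real $\varepsilon\ge0$ a perturbation radius $\mathfrak p(\varepsilon)$ such that: if $\varepsilon_k\searrow\varepsilon$ then $\mathfrak p(\varepsilon)=\bigcap_k\mathfrak p(\varepsilon_k)$; each $\mathfrak p(\varepsilon)$ is symmetric; $\mathfrak p(\varepsilon)\circ\mathfrak p(\varepsilon')\le\mathfrak p(\varepsilon+\varepsilon')$; $\mathfrak p(0)=\mathrm{id}$. Two models $M,N$ of $T$ are $\mathfrak p$-isomorphic if $\mathrm{BiPert}_{\mathfrak p(\varepsilon)}(M,N)\neq\emptyset$ for every $\varepsilon>0$. A model $M\models T$ is $\mathfrak p$-approximately $\aleph_0$-saturated if for every finite tuple $\bar a\in M$, every type $p(x,\bar a)\in S_1(\bar a)$ and every $\varepsilon>0$, the partial type $p^{\mathfrak p(\varepsilon)}(x^\varepsilon,\bar a^\varepsilon)$ is realised in $M$; that is, there is $b\in M$ and there are $b',\bar a'$ in some elementary extension of $M$ with $d(b,b')\le\varepsilon$, $d(\bar a,\bar a')\le\varepsilon$ and $\mathrm{tp}(b',\bar a')\in p(x,\bar y)^{\mathfrak p(\varepsilon)}$, where $p(x,\bar y)$ is the complete type without parameters corresponding to $p(x,\bar a)$. *)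

(* Defs.v *)
From HB Require Import structures.
From mathcomp Require Import all_boot all_order all_algebra.
From mathcomp Require Import all_classical all_reals all_analysis.

Set Implicit Arguments.
Unset Strict Implicit.
Unset Printing Implicit Defensive.

Import Order.TTheory GRing.Theory Num.Theory.
Import numFieldNormedType.Exports.

Local Open Scope classical_set_scope.
Local Open Scope ring_scope.

(* A signature fixes, besides the arities, a bound on the diameter, a compact
   interval of values for each predicate symbol, and moduli of uniform
   continuity.  Tuples in M are functions 'I_n -> M. *)
Record language (R : realType) := Language {
  diameter : R;
  fsym : Type;
  farity : fsym -> nat;
  fmodulus : fsym -> R -> R;
  fmodulus_gt0 : forall s e, 0 < e -> 0 < fmodulus s e;
  psym : Type;
  parity : psym -> nat;
  plower : psym -> R;
  pupper : psym -> R;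
  pmodulus : psym -> R -> R;
  pmodulus_gt0 : forall s e, 0 < e -> 0 < pmodulus s e }.

Record structure (R : realType) (L : language R) := Structure {
  carrier :> metricType R;
  carrier_nonempty : [set: carrier] !=set0;
  carrier_complete : forall F : set_system carrier,
    ProperFilter F -> cauchy F -> exists l : carrier, F --> l;
  carrier_bounded : forall x y : carrier, mdist x y <= diameter L;
  finterp : forall s : fsym L, ('I_(farity s) -> carrier) -> carrier;
  finterp_modulus : forall (s : fsym L) (e : R) (a b : 'I_(farity s) -> carrier),
    0 < e -> (forall i, mdist (a i) (b i) < fmodulus s e) ->
    mdist (finterp a) (finterp b) <= e;
  pinterp : forall s : psym L, ('I_(parity s) -> carrier) -> R;
  pinterp_bounded : forall (s : psym L) (a : 'I_(parity s) -> carrier),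
    plower s <= pinterp a <= pupper s;
  pinterp_modulus : forall (s : psym L) (e : R) (a b : 'I_(parity s) -> carrier),
    0 < e -> (forall i, mdist (a i) (b i) < pmodulus s e) ->
    `|pinterp a - pinterp b| <= e }.

Inductive term (R : realType) (L : language R) (n : nat) : Type :=
| TVar (i : 'I_n)
| TApp (s : fsym L) (ts : 'I_(farity s) -> term L n).

(* [formula L n]: free variables indexed by 'I_n.  Every continuous
   R^k -> R is a connective; the quantifiers bind variable 0. *)
Inductive formula (R : realType) (L : language R) : nat -> Type :=
| FDist n (t1 t2 : term L n) : formula L n
| FPred n (s : psym L) (ts : 'I_(parity s) -> term L n) : formula L n
| FConn n k (u : {ptws 'I_k -> R} -> R) (cu : continuous u)
    (args : 'I_k -> formula L n) : formula L n
| FInf n (phi : formula L n.+1) : formula L n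
| FSup n (phi : formula L n.+1) : formula L n.

HB.instance Definition _ (R : realType) (L : language R) (n : nat) :=
  gen_eqMixin (formula L n).
HB.instance Definition _ (R : realType) (L : language R) (n : nat) :=
  gen_choiceMixin (formula L n).

Definition tcons (X : Type) (n : nat) (x : X) (a : 'I_n -> X) : 'I_n.+1 -> X :=
  fun i => if unlift ord0 i is Some j then a j else x.

Fixpoint teval (R : realType) (L : language R) (M : structure L) (n : nat)
    (t : term L n) (a : 'I_n -> M) : M :=
  match t with
  | TVar i => a i
  | TApp s ts => finterp (fun i => teval (ts i) a)
  end.

Fixpoint feval (R : realType) (L : language R) (M : structure L) (n : nat)
    (phi : formula L n) : ('I_n -> M) -> R :=
  match phi in formula _ m return ('I_m -> M) -> R with
  | FDist _ t1 t2 => fun a => mdist (teval t1 a) (teval t2 a)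
  | FPred _ s ts => fun a => pinterp (fun i => teval (ts i) a)
  | FConn _ _ u _ args => fun a => u (fun i => feval (args i) a)
  | FInf _ psi => fun a => inf (range (fun x : M => feval psi (tcons x a)))
  | FSup _ psi => fun a => sup (range (fun x : M => feval psi (tcons x a)))
  end.

(* A theory is a set of closed conditions [phi = 0], given by the sentences
   [phi]; it need not be complete. *)
Definition theory (R : realType) (L : language R) := set (formula L 0).

Definition no_tuple (X : Type) : 'I_0 -> X :=
  fun i => False_rect X (notF (ltn_ord i)).

Definition satisfies (R : realType) (L : language R) (M : structure L)
    (T : theory L) : Prop :=
  forall phi, T phi -> feval phi (@no_tuple M) = 0.

Record model (R : realType) (L : language R) (T : theory L) := Model {
  model_structure :> structure L;
  model_satisfies : satisfies model_structure T }.

Definition elementarily_equivalent (R : realType) (L : language R)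
    (M N : structure L) : Prop :=
  forall phi : formula L 0, feval phi (@no_tuple M) = feval phi (@no_tuple N).

Definition elementary_embedding (R : realType) (L : language R)
    (M N : structure L) (h : M -> N) : Prop :=
  forall n (phi : formula L n) (a : 'I_n -> M), feval phi (h \o a) = feval phi a.

Definition separable (X : topologicalType) : Prop :=
  exists2 D : set X, countable D & dense D.

(* A complete type is identified with the values it gives to formulas, so the
   logic topology is the one induced by pointwise convergence. *)
Definition types (R : realType) (L : language R) (T : theory L) (n : nat) :
    set {ptws formula L n -> R} :=
  [set p | exists (M : model T) (a : 'I_n -> M), forall phi, p phi = feval phi a].
Arguments types {R L} T n _.

Lemma tp_subproof (R : realType) (L : language R) (T : theory L) (M : model T)
    (n : nat) (a : 'I_n -> M) :
  (fun phi : formula L n => feval phi a) \in types T n.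
Proof. by apply/mem_set; exists M, a. Qed.

Definition tp (R : realType) (L : language R) (T : theory L) (M : model T)
    (n : nat) (a : 'I_n -> M) : types T n :=
  exist _ (fun phi : formula L n => feval phi a) (tp_subproof a).

(* p(x, a) in S_1(a), recorded as the type p(x, y) in n+1 variables (x is
   variable 0): p(x, c) is realised in some (N, c) that satisfies the theory of
   (M, a), that is, with tp(c) = tp(a). *)
Definition types_over (R : realType) (L : language R) (T : theory L)
    (M : model T) (n : nat) (a : 'I_n -> M) : set (types T n.+1) :=
  [set p | exists (N : model T) (c : 'I_n -> N) (b : N),
     tp c = tp a /\ p = tp (tcons b c)].

Definition preradius (R : realType) (L : language R) (T : theory L) :=
  forall n, set (types T n * types T n).

Definition is_preradius (R : realType) (L : language R) (T : theory L)
    (rho : preradius T) : Prop :=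
  forall n, closed (rho n) /\ forall p, rho n (p, p).

Definition pert_image (R : realType) (L : language R) (T : theory L)
    (rho : preradius T) (n : nat) (X : set (types T n)) : set (types T n) :=
  [set q | exists2 p, X p & rho n (p, q)].

Definition Pert (R : realType) (L : language R) (T : theory L)
    (rho : preradius T) (M N : model T) : set (M -> N) :=
  [set f : M -> N | forall n (a : 'I_n -> M),
     pert_image rho [set tp a] (tp (f \o a))].
Arguments Pert {R L T} rho M N _.

Definition BiPert (R : realType) (L : language R) (T : theory L)
    (rho : preradius T) (M N : model T) : set (M -> N) :=
  [set f : M -> N | Pert rho M N f /\
     exists g : N -> M, [/\ cancel f g, cancel g f & Pert rho N M g]].
Arguments BiPert {R L T} rho M N _.

Definition is_radius (R : realType) (L : language R) (T : theory L)
    (rho : preradius T) : Prop :=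
  is_preradius rho /\
  forall n p q, rho n (p, q) ->
    exists (M N : model T) (f : M -> N) (a : 'I_n -> M),
      [/\ Pert rho M N f, tp a = p & tp (f \o a) = q].

Definition pert_symmetric (R : realType) (L : language R) (T : theory L)
    (rho : preradius T) : Prop :=
  forall n p q, rho n (p, q) -> rho n (q, p).

Definition pert_le (R : realType) (L : language R) (T : theory L)
    (rho rho' : preradius T) : Prop :=
  forall n, rho n `<=` rho' n.

Definition pert_comp (R : realType) (L : language R) (T : theory L)
    (rho' rho : preradius T) : preradius T :=
  fun n => [set pq | exists r, rho n (pq.1, r) /\ rho' n (r, pq.2)].

Definition pert_id (R : realType) (L : language R) (T : theory L) :
    preradius T :=
  fun n => [set pq | pq.1 = pq.2].
Arguments pert_id {R L} T n _.

(* Values at negative reals are irrelevant. *)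
Definition is_perturbation_system (R : realType) (L : language R)
    (T : theory L) (p : R -> preradius T) : Prop :=
  [/\ forall e, 0 <= e -> is_radius (p e),
      forall (e : R) (u : nat -> R), 0 <= e ->
        nonincreasing_seq u -> u @ \oo --> e ->
        forall n, p e n = \bigcap_k p (u k) n,
      forall e, 0 <= e -> pert_symmetric (p e),
      forall e e', 0 <= e -> 0 <= e' ->
        pert_le (pert_comp (p e) (p e')) (p (e + e')) &
      forall n, p 0 n = pert_id T n].

Record perturbation_system (R : realType) (L : language R) (T : theory L) :=
  PerturbationSystem {
    pert_at :> R -> preradius T;
    pert_atP : is_perturbation_system pert_at }.
Arguments pert_at {R L T} _ _ n _.

Definition pert_isomorphic (R : realType) (L : language R) (T : theory L)
    (p : perturbation_system T) (M N : model T) : Prop :=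
  forall e : R, 0 < e -> BiPert (p e) M N !=set0.

Definition approx_aleph0_saturated (R : realType) (L : language R)
    (T : theory L) (p : perturbation_system T) (M : model T) : Prop :=
  forall (n : nat) (a : 'I_n -> M) (q : types T n.+1) (e : R),
    types_over a q -> 0 < e ->
    exists (b : M) (N : model T) (h : M -> N) (b' : N) (a' : 'I_n -> N),
      [/\ elementary_embedding h,
          mdist (h b) b' <= e,
          forall i, mdist (h (a i)) (a' i) <= e &
          pert_image (p e) [set q] (tp (tcons b' a'))].

(* Main.v *)
Require Import Defs.
From HB Require Import structures.
From mathcomp Require Import all_boot all_order all_algebra.
From mathcomp Require Import all_classical all_reals all_analysis.
From mathcomp Require Import zify ring lra.

Set Implicit Arguments.
Unset Strict Implicit.
Unset Printing Implicit Defensive.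

Import Order.TTheory GRing.Theory Num.Theory.
Import numFieldNormedType.Exports.

Local Open Scope classical_set_scope.
Local Open Scope ring_scope.

(** The proof is a back-and-forth argument in which the tuples built so far may
    move, by amounts that are summable.

    A tuple a of M is compared with a tuple b of N through [near_pert]: in some
    elementary extension of N there is a tuple b', within d of b, such that
    (tp a, tp b') belongs to p(e).  Two properties of a perturbation radius rho
    make this relation workable.

    - [radius_extend]: if the type of b is a rho-perturbation of the type of a
      part of a, then in an elementary extension b is completed to a tuple whose
      type is a rho-perturbation of the type of all of a.  Indeed rho is
      witnessed by a map between models; the images under this map of approximate
      realisations of the type of a converge in an ultrapower, and rho is closed.
    - [radius_modulus]: all rho-perturbations have a common modulus of uniform
      continuity, since otherwise an ultraproduct would contain a perturbation
      that separates two equal points.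

    Together they allow the error d to be carried from one side to the other,
    which makes [near_pert] symmetric up to a modulus ([near_pert_sym]).

    Saturation realises a type in one variable, up to a small distance and a
    small perturbation; by induction it does so for types of tuples
    ([saturated_realise_tuple]).  In the step [forth], an element x of M has to be
    matched.  A partner y' of x is found next to b', outside N, and the tuple
    (y', b'), rather than y' alone, is then realised in N over b.  The new error
    is as small as desired, and since b' was close to b, the tuple that replaces b
    is close to b as well.

    Given E > 0, alternate the two directions while the levels increase to E and the
    errors decrease fast: every coordinate converges.  The limits are sequences al and
    be, dense in M and N, any finite parts of which have types related by p(E):
    this relation is closed, and formulas are uniformly continuous, uniformly in
    the model.  By the common modulus and completeness, the closure of the set of
    pairs (al i, be i) is the graph of a bijection, and by closedness again this
    bijection and its inverse are p(E)-perturbations. *)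

(** * Limits along filters *)

Lemma cvg_initial_topology (X : choiceType) (Y : topologicalType) (g : X -> Y)
    (I : Type) (F : set_system I) (u : I -> initial_topology g) x :
  Filter F -> (g \o u) @ F --> g x -> u @ F --> (x : initial_topology g).
Proof.
move=> FF gu A [_ [[B oB <-] Bx] BA].
have gB : F ((g \o u) @^-1` B) by apply: gu; exact: open_nbhs_nbhs.
by apply: (@filterS _ F _ ((g \o u) @^-1` B)) gB => i /BA.
Qed.

Lemma cvg_pointwise (J : choiceType) (Y : topologicalType) (I : Type)
    (F : set_system I) (u : I -> {ptws J -> Y}) (v : {ptws J -> Y}) :
  Filter F -> (forall j, (fun i => u i j) @ F --> v j) -> u @ F --> v.
Proof.
move=> FF uv; apply/cvg_sup => j; apply: cvg_initial_topology; exact: uv.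
Qed.

(** A cluster point of the image of U is a limit, because U contains every set or
    its complement. *)
Lemma ultra_cvg_compact (I : Type) (U : set_system I) (Y : topologicalType)
    (K : set Y) (u : I -> Y) :
  UltraFilter U -> compact K -> (forall i, K (u i)) ->
  exists2 y, K y & u @ U --> y.
Proof.
move=> UU cK Ku; have PU := @ultra_proper _ _ UU.
have [|y [Ky cy]] := cK (u @ U) _ _.
  exact: (@filterE _ U).
exists y => // A nA; have [//|UnA] := in_ultra_setVsetC (u @^-1` A) UU.
by have [z []] := cy (~` A) A UnA nA.
Qed.

Lemma ultra_cvg_bounded (R : realType) (I : Type) (U : set_system I)
    (u : I -> R) (B : R) :
  UltraFilter U -> (forall i, `|u i| <= B) -> exists l : R, u @ U --> l.
Proof.
move=> UU uB.
have [|l _ ul] := @ultra_cvg_compact _ U R `[- B, B]%classic u UU (@segment_compact R _ _).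
  by move=> i; rewrite /= in_itv/= -ler_norml.
by exists l.
Qed.

Lemma ultra_nat : exists2 U : set_system nat, UltraFilter U & \oo `<=` U.
Proof.
by have [U []] := ultraFilterLemma (eventually_filter); exists U.
Qed.

Lemma le_cvg_filter (R : realType) (I : Type) (F : set_system I)
    (u v : I -> R) (l l' : R) :
  ProperFilter F -> u @ F --> l -> v @ F --> l' ->
  (\forall i \near F, u i <= v i) -> l <= l'.
Proof.
move=> PF ul vl uv; rewrite -subr_ge0; apply: (cvgr_to_ge (cvgB vl ul)).
by apply: filterS uv => i; rewrite subr_ge0.
Qed.

Lemma cvg_filter_dist_le (R : realType) (I : Type) (F : set_system I)
    (u v : I -> R) (l l' e : R) :
  ProperFilter F -> u @ F --> l -> v @ F --> l' ->
  (\forall i \near F, `|u i - v i| <= e) -> `|l - l'| <= e.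
Proof. by move=> PF ul vl; exact: cvgr_to_le (cvg_norm (cvgB ul vl)). Qed.

Lemma cvg_real_unique (R : realType) (I : Type) (F : set_system I)
    (u : I -> R) (l l' : R) :
  ProperFilter F -> u @ F --> l -> u @ F --> l' -> l = l'.
Proof.
move=> PF; exact: (@cvg_unique R (@Rhausdorff R) _ (fmap_proper_filter _ PF)).
Qed.

Lemma harmonic_small (R : realType) (e : R) :
  0 < e -> exists K, forall n, (K <= n)%N -> harmonic n < e.
Proof.
move=> e0; have /cvgrPdist_lt/(_ e e0)[K _ KP] := @cvg_harmonic R.
exists K => n /KP; rewrite sub0r normrN ger0_norm//; exact: harmonic_ge0.
Qed.

Lemma half_pow_cvg (R : realType) (c : R) : (fun n => c / 2 ^+ n) @ \oo --> 0.
Proof.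
rewrite -[X in _ --> X](mulr0 c); apply: cvgM; first exact: cvg_cst.
under eq_fun do rewrite -exprVn.
by apply: cvg_expr; rewrite ger0_norm ?invr_ge0// invf_lt1// ltr1n.
Qed.

Lemma choice_dep (I : Type) (X : I -> Type) (P : forall i, X i -> Prop) :
  (forall i, exists x, P i x) -> exists f, forall i, P i (f i).
Proof. by move=> ex; exists (fun i => projT1 (cid (ex i))) => i; case: cid. Qed.

(** * Tuples *)

Lemma no_tuple_unique (X : Type) (a : 'I_0 -> X) : a = @no_tuple X.
Proof. by apply/funext => -[]. Qed.

Lemma tcons0 (X : Type) n (x : X) (a : 'I_n -> X) : tcons x a ord0 = x.
Proof. by rewrite /tcons unlift_none. Qed.

Lemma tconsS (X : Type) n (x : X) (a : 'I_n -> X) i : tcons x a (lift ord0 i) = a i.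
Proof. by rewrite /tcons liftK. Qed.

Lemma tcons_ext (X : Type) n (x : X) (a : 'I_n -> X) b :
  b ord0 = x -> (forall i, b (lift ord0 i) = a i) -> b = tcons x a.
Proof.
move=> b0 bS; apply/funext => i; rewrite /tcons.
by case: unliftP => [j ->|->].
Qed.

Lemma comp_tcons (X Y : Type) n (h : X -> Y) (x : X) (a : 'I_n -> X) :
  h \o tcons x a = tcons (h x) (h \o a).
Proof. by apply: tcons_ext => [|i] /=; rewrite (tcons0, tconsS). Qed.

Lemma tcons_eta (X : Type) n (a : 'I_n.+1 -> X) : a = tcons (a ord0) (a \o lift ord0).
Proof. exact: tcons_ext. Qed.

Section Concatenation.
Variables (X : Type) (m n : nat).

Definition tcat (c : 'I_m -> X) (a : 'I_n -> X) : 'I_(m + n) -> X :=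
  fun i => match fintype.split i with inl j => c j | inr k => a k end.

Lemma tcat_lshift c a j : tcat c a (lshift n j) = c j.
Proof. by rewrite /tcat -[lshift n j]/(unsplit (inl j)) unsplitK. Qed.

Lemma tcat_rshift c a k : tcat c a (rshift m k) = a k.
Proof. by rewrite /tcat -[rshift m k]/(unsplit (inr k)) unsplitK. Qed.

Lemma tcat_comp_lshift c a : tcat c a \o @lshift m n = c.
Proof. by apply/funext => j /=; exact: tcat_lshift. Qed.

Lemma tcat_comp_rshift c a : tcat c a \o @rshift m n = a.
Proof. by apply/funext => j /=; exact: tcat_rshift. Qed.

End Concatenation.

Lemma tcat0 (X : Type) n (c : 'I_0 -> X) (a : 'I_n -> X) :
  tcat c a = a :> ('I_n -> X).
Proof.
apply/funext => i.
by rewrite -[RHS](tcat_rshift c a); apply: (congr1 (tcat c a)); exact: val_inj.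
Qed.

Lemma tcons_tcat (X : Type) m n x (c : 'I_m -> X) (a : 'I_n -> X) :
  tcat (tcons x c) a = tcons x (tcat c a) :> ('I_(m.+1 + n) -> X).
Proof.
apply: tcons_ext => [|i].
  by rewrite -[RHS](tcons0 x c) -(tcat_lshift (tcons x c) a); apply: (congr1 (tcat (tcons x c) a)); exact: val_inj.
rewrite -[i]fintype.splitK; case: (fintype.split i) => [j|k] /=.
  rewrite tcat_lshift -[RHS](tconsS x c) -(tcat_lshift (tcons x c) a).
  by apply: (congr1 (tcat (tcons x c) a)); exact: val_inj.
rewrite tcat_rshift -[RHS](tcat_rshift (tcons x c) a).
by apply: (congr1 (tcat (tcons x c) a)); exact: val_inj.
Qed.

Section Unpack.
Variables (X : Type) (k : nat) (v : 'I_k.+2 -> X).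

(** The two new entries of a tuple come first; they are moved to the end, so
    that a coordinate keeps its position in all later tuples. *)
Definition new_last (i : nat) : X :=
  v (inord (if (i < k)%N then i.+2 else (i == k)%N)).

Lemma new_last_old (i : 'I_k) : new_last i = v (lift ord0 (lift ord0 i)).
Proof.
rewrite /new_last ltn_ord; apply: (congr1 v); apply: val_inj => /=.
by rewrite inordK// !ltnS.
Qed.

Lemma new_last_fst : new_last k = v (lift ord0 ord0).
Proof.
rewrite /new_last ltnn eqxx; apply: (congr1 v); apply: val_inj => /=.
by rewrite inordK.
Qed.

Lemma new_last_snd : new_last k.+1 = v ord0.
Proof.
rewrite /new_last ltnNge leqnSn /= gtn_eqF//; apply: (congr1 v).
by apply: val_inj => /=; rewrite inordK.
Qed.

End Unpack.

(** * Formulas *)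

Section Formulas.
Variables (R : realType) (L : language R).

Lemma pinterp_norm_le (M : structure L) (s : psym L) (a : 'I_(parity s) -> M) :
  `|pinterp a| <= `|plower s| + `|pupper s|.
Proof.
have /andP[] := pinterp_bounded a.
have := ler_norm (pupper s); have := ler_norm (- plower s).
rewrite normrN ler_norml; have := normr_ge0 (pupper s).
have := normr_ge0 (plower s); lra.
Qed.

(** The bound has to be uniform in M for the values of a formula to converge along
    an ultrafilter.  A connective is bounded because it is continuous and its
    arguments stay in a compact box. *)
Lemma feval_bounded n (phi : formula L n) :
  exists B : R, forall (M : structure L) (a : 'I_n -> M), `|feval phi a| <= B.
Proof.
elim: phi => {n} [n t1 t2|n s ts|n k u cu args IH|n phi [B IH]|n phi [B IH]].
- exists (diameter L) => M a /=.
  by rewrite ger0_norm ?mdist_ge0// carrier_bounded.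
- by exists (`|plower s| + `|pupper s|) => M a /=; exact: pinterp_norm_le.
- have [B HB] := choice IH.
  pose K : set {ptws 'I_k -> R} := [set v | forall i, `[- B i, B i]%classic (v i)].
  have cK : compact K.
    by apply: (@tychonoff _ (fun=> R) (fun i => `[- B i, B i]%classic)) => i; exact: segment_compact.
  have : compact (u @` K).
    by apply: continuous_compact => //; exact: continuous_subspaceT.
  move=> /compact_bounded[C [_ /(_ (C + 1))]]; rewrite ltrDl ltr01 => /(_ isT) HC.
  exists (C + 1) => M a /=; apply: HC; exists (fun i => feval (args i) a) => //.
  by move=> i /=; rewrite in_itv/= -ler_norml.
- exists B => M a /=; have [m _] := carrier_nonempty M.
  have B0 := le_trans (normr_ge0 _) (IH M (tcons m a)).
  have nr : range (fun x : M => feval phi (tcons x a)) !=set0 by exists (feval phi (tcons m a)), m.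
  have lb : lbound (range (fun x : M => feval phi (tcons x a))) (- B).
    by move=> _ [x _ <-]; have := IH M (tcons x a); rewrite ler_norml => /andP[].
  rewrite ler_norml lb_le_inf//=.
  apply: (@le_trans _ _ (feval phi (tcons m a))); last exact: le_trans (ler_norm _) (IH _ _).
  by apply: ge_inf; [exists (- B)|exists m].
- exists B => M a /=; have [m _] := carrier_nonempty M.
  have nr : range (fun x : M => feval phi (tcons x a)) !=set0 by exists (feval phi (tcons m a)), m.
  have ub : ubound (range (fun x : M => feval phi (tcons x a))) B.
    by move=> _ [x _ <-]; exact: le_trans (ler_norm _) (IH _ _).
  rewrite ler_norml ge_sup// andbT.
  apply: (@le_trans _ _ (feval phi (tcons m a))).
    by have := IH M (tcons m a); rewrite ler_norml => /andP[].
  by apply: ub_le_sup; [exists B|exists m].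
Qed.

Lemma feval_inf_le n (phi : formula L n.+1) (M : structure L) a (x : M) :
  feval (FInf phi) a <= feval phi (tcons x a).
Proof.
have [B HB] := feval_bounded phi.
apply: ge_inf; last by exists x.
by exists (- B) => _ [y _ <-]; have := HB M (tcons y a); rewrite ler_norml => /andP[].
Qed.

Lemma feval_sup_ge n (phi : formula L n.+1) (M : structure L) a (x : M) :
  feval phi (tcons x a) <= feval (FSup phi) a.
Proof.
have [B HB] := feval_bounded phi.
apply: ub_le_sup; last by exists x.
by exists B => _ [y _ <-]; exact: le_trans (ler_norm _) (HB _ _).
Qed.

Lemma feval_inf_lt n (phi : formula L n.+1) (M : structure L) (a : 'I_n -> M) c :
  feval (FInf phi) a < c -> exists x, feval phi (tcons x a) < c.
Proof.
have [m _] := carrier_nonempty M.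
move=> /inf_lt [|_ [x _ <-] xc]; last by exists x.
by exists (feval phi (tcons m a)), m.
Qed.

Lemma feval_sup_gt n (phi : formula L n.+1) (M : structure L) (a : 'I_n -> M) c :
  c < feval (FSup phi) a -> exists x, c < feval phi (tcons x a).
Proof.
have [m _] := carrier_nonempty M.
move=> /sup_gt [|_ [x _ <-] xc]; last by exists x.
by exists (feval phi (tcons m a)), m.
Qed.

Fixpoint trename n m (f : 'I_n -> 'I_m) (t : term L n) : term L m :=
  match t with
  | TVar i => TVar L (f i)
  | TApp s ts => TApp (fun i => trename f (ts i))
  end.

Definition lift_map n m (f : 'I_n -> 'I_m) : 'I_n.+1 -> 'I_m.+1 :=
  tcons ord0 (lift ord0 \o f).

Fixpoint frename n (phi : formula L n) : forall m, ('I_n -> 'I_m) -> formula L m :=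
  match phi in formula _ n0 return forall m, ('I_n0 -> 'I_m) -> formula L m with
  | FDist _ t1 t2 => fun m f => FDist (trename f t1) (trename f t2)
  | FPred _ s ts => fun m f => FPred (fun i => trename f (ts i))
  | FConn _ _ u cu args => fun m f => FConn cu (fun i => frename (args i) f)
  | FInf _ psi => fun m f => FInf (frename psi (lift_map f))
  | FSup _ psi => fun m f => FSup (frename psi (lift_map f))
  end.

Lemma tcons_lift_map (X : Type) n m (f : 'I_n -> 'I_m) (x : X) (a : 'I_m -> X) :
  tcons x a \o lift_map f = tcons x (a \o f).
Proof.
by apply: tcons_ext => [|i] /=; rewrite /lift_map ?tcons0// tconsS/= tconsS.
Qed.

Lemma teval_rename n m (f : 'I_n -> 'I_m) (t : term L n) (M : structure L)
    (a : 'I_m -> M) : teval (trename f t) a = teval t (a \o f).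
Proof. by elim: t => //= s ts IH; congr finterp; apply/funext => i. Qed.

Lemma feval_rename n (phi : formula L n) m (f : 'I_n -> 'I_m) (M : structure L)
    (a : 'I_m -> M) : feval (frename phi f) a = feval phi (a \o f).
Proof.
elim: phi m f M a => {n} [n t1 t2|n s ts|n k u cu args IH|n phi IH|n phi IH] m f M a /=.
- by rewrite !teval_rename.
- by congr pinterp; apply/funext => i; rewrite teval_rename.
- by congr u; apply/funext => i.
- under eq_fun => x do rewrite IH tcons_lift_map.
  by [].
- under eq_fun => x do rewrite IH tcons_lift_map.
  by [].
Qed.

End Formulas.

(** * Completeness and separability *)

Lemma mdist_cvg_limit (R : realType) (L : language R) (N : structure L)
    (x : nat -> N) (e : nat -> R) :
  e @ \oo --> 0 -> (forall n m, (n <= m)%N -> mdist (x n) (x m) <= e n) ->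
  exists l, forall n, mdist (x n) l <= e n.
Proof.
move=> e0 xe; have [|l xl] := @carrier_complete _ _ N (x @ \oo) _.
  apply/cauchyP => r r0; have /cvgrPdist_lt /(_ r r0) [n _ /(_ n)] := e0.
  rewrite /= sub0r normrN leqnn => /(_ isT) enr; exists (x n).
  exists n => // m /= nm; rewrite ballEmdist /=.
  exact: le_lt_trans (xe _ _ nm) (le_lt_trans (ler_norm _) enr).
exists l => n; apply/ler_addgt0Pr => r r0.
have [k _ kr] := metricType_numDomainType.cvgr_dist_lt xl r0.
apply: le_trans (metric_triangle _ (x (maxn n k)) _) _.
rewrite lerD ?xe ?leq_maxl// metric_sym ltW//; apply: kr; exact: leq_maxr.
Qed.

(** A prescribed rate of convergence is what makes it possible, in an ultraproduct,
    to choose limits coordinatewise. *)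
Lemma complete_from_sequences (R : realType) (X : metricType R) :
  (forall x : nat -> X,
    (forall n m, mdist (x n) (x m) < harmonic n + harmonic m) ->
    exists l, forall n, mdist (x n) l <= harmonic n *+ 2) ->
  forall F : set_system X, ProperFilter F -> cauchy F -> exists l : X, F --> l.
Proof.
move=> seqX F PF /cauchyP cF.
have /choice[x Fx] n : exists x, F (ball x (harmonic n)).
  by apply: cF; exact: harmonic_gt0.
have [|l xl] := seqX x.
  move=> n m; have [z []] := filter_ex (filterI (Fx n) (Fx m)).
  rewrite !ballEmdist /= => xn xm.
  by apply: le_lt_trans (metric_triangle _ z _) _; rewrite ltrD// metric_sym.
exists l; apply/metricType_numDomainType.fcvgrPdist_lt => r r0.
have /cvgrPdist_lt /(_ (r / 3)) := @cvg_harmonic R.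
rewrite divr_gt0// => /(_ isT) [n _ /(_ n)] /=.
rewrite leqnn sub0r normrN ger0_norm ?invr_ge0// => /(_ isT) nr.
apply: filterS (Fx n) => z; rewrite ballEmdist /= => nz.
apply: le_lt_trans (metric_triangle _ (x n) _) _; rewrite metric_sym.
have := xl n; rewrite /= in nz *; rewrite mulr2n.
by move: (n.+1%:R^-1) nr nz => h; lra.
Qed.

Lemma telescoping_limit (R : realType) (L : language R) (N : structure L)
    (x : nat -> N) (q : nat -> R) (K : nat) :
  q @ \oo --> 0 -> (forall n, 0 <= q n) ->
  (forall n, (K <= n)%N -> mdist (x n) (x n.+1) <= q n - q n.+1) ->
  exists l, forall n, (K <= n)%N -> mdist (x n) l <= q n.
Proof.
move=> q0 q_ge0 xq.
have [||l lP] := @mdist_cvg_limit _ _ N (fun n => x (n + K)%N) (fun n => q (n + K)%N).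
- by rewrite (cvg_shiftn K).
- move=> n m nm; apply: (@le_trans _ _ (q (n + K)%N - q (m + K)%N)); last first.
    by rewrite gerBl.
  elim: m nm => [|m IH]; first by rewrite leqn0 => /eqP ->; rewrite mdistxx subrr.
  rewrite leq_eqVlt => /predU1P[->|/IH nm]; first by rewrite mdistxx subrr.
  apply: le_trans (metric_triangle _ (x (m + K)%N) _) _.
  have := xq (m + K)%N (leq_addl _ _); rewrite addSn; lra.
by exists l => n Kn; rewrite -(subnK Kn); exact: lP.
Qed.

(** The exponent of 2 in n + 1 takes every value infinitely often, so that every
    term of a dense sequence is repeated at arbitrarily late stages. *)
Lemma dense_sequence (R : realType) (L : language R) (M : structure L) :
  separable M -> exists c : nat -> M, forall (x : M) (e : R) (K : nat), 0 < e ->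
    exists2 n, (K <= n)%N & mdist (c n) x < e.
Proof.
move=> [D /countable_injP[f fI] dD]; have [x0 _] := carrier_nonempty M.
pose u i := xget x0 (D `&` [set x | f x = i]).
exists (fun n => u (logn 2 n.+1)) => x e K e0.
have [||y [xy Dy]] := dD (ball x e)^°; first by exists x; exact: nbhsx_ballx.
  exact: open_interior.
move/interior_subset: xy; rewrite ballEmdist /= => xy.
exists (2 ^ f y * K.*2.+1).-1%N.
  rewrite -ltnS prednK ?muln_gt0 ?expn_gt0//.
  apply: (@leq_trans K.*2.+1); first by rewrite ltnS -addnn leq_addr.
  by rewrite leq_pmull// expn_gt0.
rewrite prednK ?muln_gt0 ?expn_gt0// lognM ?expn_gt0// pfactorK//.
rewrite (_ : logn 2 K.*2.+1 = 0%N) ?addn0; last first.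
  by rewrite lognE /= dvdn2 /= odd_double.
have -> : u (f y) = y; last by rewrite metric_sym.
rewrite /u; case: xgetP => [z _ [Dz fz]|/(_ y) nDy]; last by case: nDy.
by apply: fI; rewrite ?inE.
Qed.

(** * Ultraproducts *)

Section Ultraproduct.
Variables (R : realType) (L : language R) (I : Type) (M : I -> structure L).
Variables (U : set_system I) (UU : UltraFilter U).

Local Notation family := (forall i, M i).

Let PU : ProperFilter U. Proof. exact: ultra_proper. Qed.
#[local] Existing Instance PU.

Definition ulim (u : I -> R) : R := lim (u @ U).

Lemma ulimE u l : u @ U --> l -> ulim u = l.
Proof. exact: cvg_lim. Qed.

Lemma ulim_cvg u B : (forall i, `|u i| <= B) -> u @ U --> ulim u.
Proof.
by move=> uB; have [l ul] := ultra_cvg_bounded UU uB; rewrite (ulimE ul).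
Qed.

Definition udist (x y : family) : R := ulim (fun i => mdist (x i) (y i)).

Lemma udist_cvg x y : (fun i => mdist (x i) (y i)) @ U --> udist x y.
Proof.
apply: (@ulim_cvg _ (diameter L)) => i.
by rewrite ger0_norm ?mdist_ge0// carrier_bounded.
Qed.

Lemma udistxx x : udist x x = 0.
Proof.
apply: ulimE; apply: cvg_near_cst; apply: nearW => i; exact: mdistxx.
Qed.

Lemma udistC x y : udist x y = udist y x.
Proof. by congr ulim; apply/funext => i; rewrite metric_sym. Qed.

Lemma udist_triangle y x z : udist x z <= udist x y + udist y z.
Proof.
refine (le_cvg_filter PU (@udist_cvg x z) (cvgD (@udist_cvg x y) (@udist_cvg y z)) _).
by apply: nearW => i; exact: metric_triangle.
Qed.

(** Points at distance zero have to be identified; a point is represented by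
    its distance function, so that equality of points is equality of
    functions. *)
Definition ultraproduct : Type := {c : family -> R | `[< exists x, c = udist x >]}.

HB.instance Definition _ := gen_eqMixin ultraproduct.
HB.instance Definition _ := gen_choiceMixin ultraproduct.

Definition uclass (x : family) : ultraproduct :=
  exist _ (udist x) (asboolT (ex_intro _ x erefl)).

Definition urepr (c : ultraproduct) : family := projT1 (cid (asboolW (valP c))).

Lemma ureprK c : uclass (urepr c) = c.
Proof.
rewrite /urepr; case: cid => x /= cx.
by apply: val_inj; rewrite /= -cx.
Qed.

Lemma uclass_eq x y : udist x y = 0 -> uclass x = uclass y.
Proof.
move=> xy0; apply: val_inj; apply/funext => z /=; apply/eqP; rewrite eq_le.
have := udist_triangle y x z; have := udist_triangle x y z.
by rewrite (udistC y x) xy0 !add0r => -> ->.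
Qed.

Definition umdist (c c' : ultraproduct) := udist (urepr c) (urepr c').

Lemma umdistxx c : umdist c c = 0.
Proof. exact: udistxx. Qed.
Lemma umdist_positivity c c' : umdist c c' = 0 -> c = c'.
Proof. by move=> /uclass_eq; rewrite !ureprK. Qed.
Lemma umdistC c c' : umdist c c' = umdist c' c.
Proof. exact: udistC. Qed.
Lemma umdist_triangle c' c c'' : umdist c c'' <= umdist c c' + umdist c' c''.
Proof. exact: udist_triangle. Qed.

HB.instance Definition _ := @isMetric.Build R ultraproduct umdist
  umdistxx umdist_positivity umdistC umdist_triangle.

Lemma udist_urepr x : udist (urepr (uclass x)) x = 0.
Proof.
have /(congr1 val) /= /(congr1 (@^~ x)) /= -> := ureprK (uclass x).
exact: udistxx.
Qed.

Lemma mdist_uclass x y : mdist (uclass x) (uclass y) = udist x y.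
Proof.
rewrite {1}/mdist /= /umdist.
have x0 := udist_urepr x; have y0 := udist_urepr y.
apply/eqP; rewrite eq_le; apply/andP; split.
  apply: le_trans (@udist_triangle x _ _) _; rewrite x0 add0r.
  by apply: le_trans (@udist_triangle y _ _) _; rewrite (udistC y) y0 addr0.
apply: le_trans (@udist_triangle (urepr (uclass x)) _ _) _.
rewrite udistC x0 add0r.
by apply: le_trans (@udist_triangle (urepr (uclass y)) _ _) _; rewrite y0 addr0.
Qed.

Lemma uclass_surj (c : ultraproduct) : exists x, c = uclass x.
Proof. by exists (urepr c); rewrite ureprK. Qed.

(** The sets A n of coordinates in which the first terms are as close as they are
    in the ultraproduct belong to U and decrease.  In a coordinate that belongs to
    all of them the terms converge; in any other coordinate the last term before
    the estimates fail can serve as the limit. *)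
Lemma ultraproduct_complete (F : set_system ultraproduct) :
  ProperFilter F -> cauchy F -> exists l : ultraproduct, F --> l.
Proof.
apply: complete_from_sequences F => c cc.
have /choice[x cE] n := uclass_surj (c n).
pose close i k m := mdist (x k i) (x m i) < harmonic k + harmonic m.
pose A n : set I := [set i | forall k m : 'I_n.+1, close i k m].
have UA n : U (A n).
  apply: filter_forall => k; apply: filter_forall => m.
  have := cc k m; rewrite !cE mdist_uclass.
  exact: cvgr_lt (@udist_cvg _ _) _.
have A_S n i : A n.+1 i -> A n i.
  by move=> An k m; exact: (An (widen_ord (leqnSn _) k) (widen_ord (leqnSn _) m)).
have Adist i n k : (k <= n)%N -> A n i -> mdist (x k i) (x n i) <= harmonic k *+ 2.
  move=> kn An; have kn' : (k < n.+1)%N by [].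
  have /ltW/le_trans := An (Ordinal kn') ord_max; apply.
  by rewrite mulr2n lerD2l /= lef_pV2 ?posrE// ler_nat.
have limit i : exists y, forall n, A n i -> mdist (x n i) y <= harmonic n *+ 2.
  have [Aall|/existsNP nA] := pselect (forall n, A n i).
    have [||y yP] := @mdist_cvg_limit _ _ (M i) (x^~ i) (fun n => harmonic n *+ 2).
    - rewrite -[X in _ --> X](mul0rn _ 2); apply: cvgMn; exact: cvg_harmonic.
    - by move=> n m nm; exact: Adist.
    - by exists y.
  have ex : exists n, `[< ~ A n i >] by case: nA => n An; exists n; apply/asboolP.
  have [m /asboolP Am mmin] := ex_minnP ex.
  have Ale n : A n i -> (n < m)%N.
    move=> An; rewrite ltnNge; apply/negP => mn; apply: Am.
    by elim: n An mn => [|n IH] An; [rewrite leqn0 => /eqP->|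
      rewrite leq_eqVlt => /predU1P[->//|]; exact: IH (A_S _ _ An)].
  exists (x m.-1 i) => n An; have nm := Ale n An.
  have m0 : (0 < m)%N by exact: leq_ltn_trans nm.
  apply: Adist; first by rewrite -ltnS prednK.
  apply: contrapT => Am1; have /mmin : `[< ~ A m.-1 i >] by apply/asboolP.
  by rewrite leqNgt prednK// leqnn.
exists (uclass (fun i => projT1 (cid (limit i)))) => n.
rewrite cE mdist_uclass.
apply: (cvgr_to_le (@udist_cvg _ _)).
apply: filterS (UA n) => i An; case: cid => y /= yP; exact: yP.
Qed.

Lemma ultraproduct_nonempty : [set: ultraproduct] !=set0.
Proof. by exists (uclass (fun i => projT1 (cid (carrier_nonempty (M i))))). Qed.

Lemma ultraproduct_bounded (c c' : ultraproduct) : mdist c c' <= diameter L.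
Proof.
apply: (cvgr_to_le (@udist_cvg (urepr c) (urepr c'))).
by apply: nearW => i; exact: carrier_bounded.
Qed.

Definition at_index n (x : 'I_n -> family) (i : I) : 'I_n -> M i :=
  fun k => x k i.

Definition ufinterp (s : Defs.fsym L) (c : 'I_(farity s) -> ultraproduct) : ultraproduct :=
  uclass (fun i => finterp (at_index (urepr \o c) i)).

Lemma ufinterp_modulus (s : Defs.fsym L) (e : R) (a b : 'I_(farity s) -> ultraproduct) :
  0 < e -> (forall k, mdist (a k) (b k) < fmodulus s e) ->
  mdist (ufinterp a) (ufinterp b) <= e.
Proof.
move=> e0 ab; rewrite mdist_uclass; apply: (cvgr_to_le (@udist_cvg _ _)).
have : U [set i | forall k, mdist (urepr (a k) i) (urepr (b k) i) < fmodulus s e].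
  by apply: filter_forall => k; exact: cvgr_lt (@udist_cvg _ _) _ (ab k).
by apply: filterS => i abi; exact: finterp_modulus.
Qed.

Definition upinterp (s : psym L) (c : 'I_(parity s) -> ultraproduct) : R :=
  ulim (fun i => pinterp (at_index (urepr \o c) i)).

Lemma pinterp_cvg (s : psym L) (x : 'I_(parity s) -> family) :
  (fun i => pinterp (at_index x i)) @ U --> ulim (fun i => pinterp (at_index x i)).
Proof.
by apply: (@ulim_cvg _ (`|plower s| + `|pupper s|)) => i; exact: pinterp_norm_le.
Qed.

Lemma upinterp_bounded (s : psym L) (c : 'I_(parity s) -> ultraproduct) :
  plower s <= upinterp c <= pupper s.
Proof.
apply/andP; split.
  apply: (cvgr_to_ge (@pinterp_cvg _ _)).
  by apply: nearW => i; have /andP[] := pinterp_bounded (at_index (urepr \o c) i).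
apply: (cvgr_to_le (@pinterp_cvg _ _)).
by apply: nearW => i; have /andP[] := pinterp_bounded (at_index (urepr \o c) i).
Qed.

Lemma upinterp_modulus (s : psym L) (e : R) (a b : 'I_(parity s) -> ultraproduct) :
  0 < e -> (forall k, mdist (a k) (b k) < pmodulus s e) ->
  `|upinterp a - upinterp b| <= e.
Proof.
move=> e0 ab.
apply: (cvg_filter_dist_le PU (@pinterp_cvg _ _) (@pinterp_cvg _ _)).
have : U [set i | forall k, mdist (urepr (a k) i) (urepr (b k) i) < pmodulus s e].
  by apply: filter_forall => k; exact: cvgr_lt (@udist_cvg _ _) _ (ab k).
by apply: filterS => i abi; exact: pinterp_modulus.
Qed.

Definition ultraproduct_structure : structure L := @Structure R L ultraproduct
  ultraproduct_nonempty ultraproduct_complete ultraproduct_bounded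
  ufinterp ufinterp_modulus upinterp upinterp_bounded upinterp_modulus.

Local Notation N := ultraproduct_structure.

(** By uniform continuity the interpretation does not depend on the
    representatives. *)
Lemma uclass_finterp (s : Defs.fsym L) (x : 'I_(farity s) -> family) :
  finterp (uclass \o x : _ -> N) = uclass (fun i => finterp (at_index x i)).
Proof.
apply: uclass_eq; apply/eqP; rewrite eq_le; apply/andP; split; last first.
  apply: (cvgr_to_ge (@udist_cvg _ _)).
  by apply: nearW => i; exact: mdist_ge0.
apply/ler_addgt0Pr => e e0; rewrite add0r; apply: (cvgr_to_le (@udist_cvg _ _)).
have : U [set i | forall k, mdist (urepr (uclass (x k)) i) (x k i) < fmodulus s e].
  apply: filter_forall => k.
  have d0 : udist (urepr (uclass (x k))) (x k) < fmodulus s e.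
    by rewrite udist_urepr fmodulus_gt0.
  exact: cvgr_lt (@udist_cvg _ _) _ d0.
by apply: filterS => i abi; exact: finterp_modulus.
Qed.

Lemma upinterp_cvg (s : psym L) (x : 'I_(parity s) -> family) :
  (fun i => pinterp (at_index x i)) @ U --> pinterp (uclass \o x : _ -> N).
Proof.
suff -> : pinterp (uclass \o x : _ -> N) = ulim (fun i => pinterp (at_index x i)).
  exact: pinterp_cvg.
apply/eqP; rewrite -subr_eq0 -normr_eq0 eq_le normr_ge0 andbT.
apply/ler_addgt0Pr => e e0; rewrite add0r.
apply: (cvg_filter_dist_le PU (@pinterp_cvg _ _) (@pinterp_cvg _ _)).
have : U [set i | forall k, mdist (urepr (uclass (x k)) i) (x k i) < pmodulus s e].
  apply: filter_forall => k.
  have d0 : udist (urepr (uclass (x k))) (x k) < pmodulus s e.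
    by rewrite udist_urepr pmodulus_gt0.
  exact: cvgr_lt (@udist_cvg _ _) _ d0.
by apply: filterS => i abi; exact: pinterp_modulus.
Qed.

Lemma teval_uclass n (t : term L n) (x : 'I_n -> family) :
  teval t (uclass \o x : _ -> N) = uclass (fun i => teval t (at_index x i)).
Proof.
elim: t => // s ts IH /=.
transitivity (finterp (uclass \o (fun k i => teval (ts k) (at_index x i)) : _ -> N)).
  by congr (@finterp R L N s _); apply/funext => k; exact: IH.
exact: uclass_finterp.
Qed.

Lemma at_index_tcons n (y : family) (x : 'I_n -> family) i :
  at_index (tcons y x) i = tcons (y i) (at_index x i).
Proof. by apply: tcons_ext => [|k]; rewrite /at_index (tcons0, tconsS). Qed.

(** In the quantifier steps a witness that is optimal up to e is chosen in every
    coordinate; the uniform bounds ensure that the values of the quantified formula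
    converge. *)
Lemma Los n (phi : formula L n) (x : 'I_n -> family) :
  (fun i => feval phi (at_index x i)) @ U --> feval phi (uclass \o x : _ -> N).
Proof.
elim: phi x => {n} [n t1 t2|n s ts|n k u cu args IH|n phi IH|n phi IH] x.
- by rewrite /= !teval_uclass mdist_uclass; exact: udist_cvg.
- rewrite /=; have -> : (fun k => teval (ts k) (uclass \o x : _ -> N)) =
            uclass \o (fun k i => teval (ts k) (at_index x i)).
    by apply/funext => k; exact: teval_uclass.
  exact: upinterp_cvg.
- pose w i : {ptws 'I_k -> R} := fun j => feval (args j) (at_index x i).
  pose v : {ptws 'I_k -> R} := fun j => feval (args j) (uclass \o x : _ -> N).
  have wv : w @ U --> v by apply: cvg_pointwise => j; exact: IH.
  exact: (cvg_comp w u wv (cu v)).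
- have [B HB] := feval_bounded (FInf phi).
  have cI := @ulim_cvg (fun i => feval (FInf phi) (at_index x i)) B (fun i => HB _ _).
  suff <- : ulim (fun i => feval (FInf phi) (at_index x i)) =
      feval (FInf phi) (uclass \o x : _ -> N) by exact: cI.
  apply/eqP; rewrite eq_le; apply/andP; split.
    apply: lb_le_inf.
      by have [m _] := carrier_nonempty N; exists (feval phi (tcons m (uclass \o x))), m.
    move=> _ [c _ <-]; have [y ->] := uclass_surj c; rewrite -comp_tcons.
    apply: (le_cvg_filter _ cI (IH _)); apply: nearW => i.
    by rewrite at_index_tcons; exact: feval_inf_le.
  apply/ler_addgt0Pr => e e0.
  have /choice_dep : forall i, exists y : M i,
      feval phi (tcons y (at_index x i)) <= feval (FInf phi) (at_index x i) + e.
    move=> i; have [|y ye] := @feval_inf_lt _ _ _ phi _ (at_index x i)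
      (feval (FInf phi) (at_index x i) + e); first by rewrite ltrDl.
    by exists y; exact: ltW.
  move=> [y ye].
  apply: le_trans (@feval_inf_le _ _ _ phi N (uclass \o x) (uclass y)) _.
  rewrite -comp_tcons.
  apply: (le_cvg_filter _ (IH _) (cvgD cI (cvg_cst e))); apply: nearW => i.
  by rewrite at_index_tcons; exact: ye.
- have [B HB] := feval_bounded (FSup phi).
  have cI := @ulim_cvg (fun i => feval (FSup phi) (at_index x i)) B (fun i => HB _ _).
  suff <- : ulim (fun i => feval (FSup phi) (at_index x i)) =
      feval (FSup phi) (uclass \o x : _ -> N) by exact: cI.
  apply/eqP; rewrite eq_le; apply/andP; split; last first.
    apply: ge_sup.
      by have [m _] := carrier_nonempty N; exists (feval phi (tcons m (uclass \o x))), m.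
    move=> _ [c _ <-]; have [y ->] := uclass_surj c; rewrite -comp_tcons.
    apply: (le_cvg_filter _ (IH _) cI); apply: nearW => i.
    by rewrite at_index_tcons; exact: feval_sup_ge.
  apply/ler_addgt0Pr => e e0.
  have /choice_dep : forall i, exists y : M i,
      feval (FSup phi) (at_index x i) <= feval phi (tcons y (at_index x i)) + e.
    move=> i; have [|y ye] := @feval_sup_gt _ _ _ phi _ (at_index x i)
      (feval (FSup phi) (at_index x i) - e); first by rewrite ltrBlDr ltrDl.
    by exists y; rewrite -lerBlDr; exact: ltW.
  move=> [y ye].
  apply: (@le_trans _ _ (feval phi (tcons (uclass y : N) (uclass \o x)) + e)); last first.
    by rewrite lerD2r; exact: feval_sup_ge.
  rewrite -comp_tcons.
  apply: (le_cvg_filter _ cI (cvgD (IH _) (cvg_cst e))); apply: nearW => i.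
  by have := ye i; rewrite -at_index_tcons.
Qed.

End Ultraproduct.

(** * Types and their approximation *)

Section Types.
Variables (R : realType) (L : language R) (T : theory L).

Lemma tpP (M N : model T) n (a : 'I_n -> M) (b : 'I_n -> N) :
  tp a = tp b <-> forall phi : formula L n, feval phi a = feval phi b.
Proof.
split=> [/(congr1 val) /= ab phi|ab]; first exact: (congr1 (@^~ phi) ab).
by apply: val_inj; apply/funext => phi; exact: ab.
Qed.

Lemma tp_comp (M N : model T) n m (f : 'I_n -> 'I_m) (a : 'I_m -> M) (b : 'I_m -> N) :
  tp a = tp b -> tp (a \o f) = tp (b \o f).
Proof.
by move=> /tpP ab; apply/tpP => phi; rewrite -(feval_rename phi f a) ab feval_rename.
Qed.

Lemma tp_elementary (M N : model T) (h : M -> N) n (a : 'I_n -> M) :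
  elementary_embedding h -> tp (h \o a) = tp a.
Proof. by move=> hE; apply/tpP => phi; exact: hE. Qed.

Lemma tp_dist (M N : model T) n (a : 'I_n -> M) (b : 'I_n -> N) i j :
  tp a = tp b -> mdist (a i) (a j) = mdist (b i) (b j).
Proof. by move=> /tpP /(_ (FDist (TVar L i) (TVar L j))). Qed.

Lemma elementary_dist (M N : model T) (h : M -> N) x y :
  elementary_embedding h -> mdist (h x) (h y) = mdist x y.
Proof.
move=> hE; have := tp_dist ord0 (lift ord0 ord0)
  (tp_elementary (tcons x (fun=> y : M) : 'I_2 -> M) hE).
by rewrite /= tcons0 tconsS.
Qed.

Lemma elementary_comp (M N P : model T) (h : M -> N) (k : N -> P) :
  elementary_embedding h -> elementary_embedding k -> elementary_embedding (k \o h).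
Proof. by move=> hE kE n phi a; rewrite -hE -kE. Qed.

Lemma elementary_id (M : model T) : elementary_embedding (@id M).
Proof. by []. Qed.

(** Since [Los] also evaluates sentences, the ultraproduct is again a model of T;
    pi sends a family of elements to its class. *)
Lemma ultraproduct_of_models (I : Type) (M : I -> model T) (U : set_system I) :
  UltraFilter U -> exists (N : model T) (pi : (forall i, M i) -> N),
    forall n (phi : formula L n) (x : 'I_n -> forall i, M i),
      (fun i => feval phi (x^~ i : 'I_n -> M i)) @ U --> feval phi (pi \o x).
Proof.
move=> UU; have PU := @ultra_proper _ _ UU.
pose M' i : structure L := M i; pose N := ultraproduct_structure M' UU.
have sat : satisfies N T.
  move=> phi Tphi.
  have lim_phi := @Los _ _ _ M' _ UU _ phi (@no_tuple (forall i, M' i)).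
  rewrite -[@no_tuple _](no_tuple_unique (uclass U \o @no_tuple (forall i, M' i))).
  apply: (@cvg_unique R (@Rhausdorff R) _ (fmap_proper_filter _ PU) _ _ lim_phi).
  apply: cvg_near_cst; apply: nearW => i.
  by rewrite -(model_satisfies (M i) Tphi) [at_index _ _]no_tuple_unique.
exists (Model sat), (uclass U) => n phi x; exact: (@Los _ _ _ M' _ UU).
Qed.

(** Closedness of rho, read through the description of the logic topology as
    pointwise convergence of the values of formulas. *)
Lemma preradius_limit (rho : preradius T) (I : Type) (F : set_system I)
    (M N : I -> model T) (M0 N0 : model T) n (a : forall i, 'I_n -> M i)
    (b : forall i, 'I_n -> N i) (a0 : 'I_n -> M0) (b0 : 'I_n -> N0) :
  is_preradius rho -> ProperFilter F ->
  (forall phi : formula L n, (fun i => feval phi (a i)) @ F --> feval phi a0) ->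
  (forall phi : formula L n, (fun i => feval phi (b i)) @ F --> feval phi b0) ->
  (forall i, rho n (tp (a i), tp (b i))) -> rho n (tp a0, tp b0).
Proof.
move=> /(_ n)[rhoC _] PF aa0 bb0 rab.
pose u i : types T n * types T n := (tp (a i), tp (b i)).
apply: (@closed_cvg _ _ F _ u (rho n) rhoC _ (tp a0, tp b0)).
  by apply: nearW.
have ca : (fun i => tp (a i)) @ F --> tp a0.
  by apply: cvg_initial_topology; apply: cvg_pointwise => phi; exact: aa0.
have cb : (fun i => tp (b i)) @ F --> tp b0.
  by apply: cvg_initial_topology; apply: cvg_pointwise => phi; exact: bb0.
exact: (cvg_pair ca cb).
Qed.

Lemma proj_cvg n (v : {ptws 'I_n -> R}) i : (fun w : {ptws 'I_n -> R} => w i) @ v --> v i.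
Proof. exact: (@proj_continuous _ (fun=> R) i v). Qed.

Let max2 (v : {ptws 'I_2 -> R}) : R := Num.max (v ord0) (v (lift ord0 ord0)).

Let max2_continuous : continuous max2.
Proof.
move=> v; exact: (@continuous_max R {ptws 'I_2 -> R} (fun v => v ord0)
  (fun v => v (lift ord0 ord0)) v (@proj_cvg _ v _) (@proj_cvg _ v _)).
Qed.

Let close_to r e (v : {ptws 'I_1 -> R}) : R := `|v ord0 - r| - e.

Let close_to_continuous r e : continuous (close_to r e).
Proof.
move=> v; have v0 := @proj_cvg _ v ord0.
exact: (cvgB (cvg_norm (cvgB v0 (cvg_cst r))) (cvg_cst e)).
Qed.

Lemma feval_max n (phi psi : formula L n) :
  exists chi : formula L n, forall (M : structure L) (a : 'I_n -> M),
    feval chi a = Num.max (feval phi a) (feval psi a).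
Proof.
exists (FConn max2_continuous (tcons phi (fun=> psi))) => M a.
by rewrite /= /max2 tcons0 tconsS.
Qed.

Lemma feval_close_to n (phi : formula L n) r e :
  exists chi : formula L n, forall (M : structure L) (a : 'I_n -> M),
    feval chi a = `|feval phi a - r| - e.
Proof. by exists (FConn (@close_to_continuous r e) (fun=> phi)). Qed.

(** The conditions chi < 0 that hold of x over a form the base of a filter on N.
    Each is satisfied in N, since the infimum of chi is negative at a, hence at b;
    two of them are combined by taking a maximum. *)
Lemma type_approximation (M N : model T) n (a : 'I_n -> M) (b : 'I_n -> N) (x : M) :
  tp a = tp b -> exists2 F : set_system N, ProperFilter F &
    forall phi : formula L n.+1,
      (fun y => feval phi (tcons y b)) @ F --> feval phi (tcons x a).
Proof.
move=> /tpP ab.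
pose neg chi := feval chi (tcons x a) < 0.
pose B (chi : formula L n.+1) : set N := [set y | feval chi (tcons y b) < 0].
have PF : ProperFilter (filter_from neg B).
  apply: filter_from_proper; first apply: filter_from_filter.
  - have [chi chiE] := feval_close_to (FDist (TVar L ord0) (TVar L ord0) : formula L n.+1) 0 1.
    by exists chi; rewrite /neg chiE /= mdistxx subr0 normr0 sub0r ltrN10.
  - move=> chi psi chi0 psi0; have [th thE] := feval_max chi psi.
    exists th; first by rewrite /neg thE gt_max; apply/andP.
    by move=> y; rewrite /B /= thE gt_max => /andP.
  - move=> chi chi0; apply: feval_inf_lt; rewrite -ab.
    exact: le_lt_trans (feval_inf_le _ _ _) chi0.
exists (filter_from neg B) => // phi; apply/cvgrPdist_lt => e e0.
have [chi chiE] := feval_close_to phi (feval phi (tcons x a)) e.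
exists chi => [|y]; first by rewrite /neg chiE subrr normr0 sub0r oppr_lt0.
by rewrite /B /= chiE subr_lt0 distrC.
Qed.

End Types.

(** * Perturbation radii *)

Section Radii.
Variables (R : realType) (L : language R) (T : theory L).

Lemma ultrapower_diagonal (M N : model T) (I : Type) (U : set_system I)
    (pi : (I -> M) -> N) :
  UltraFilter U ->
  (forall n (phi : formula L n) (x : 'I_n -> I -> M),
    (fun i => feval phi (x^~ i)) @ U --> feval phi (pi \o x)) ->
  elementary_embedding (fun z => pi (fun=> z)).
Proof.
move=> UU piE n phi a; have PU := @ultra_proper _ _ UU.
apply: (cvg_real_unique PU (piE n phi (fun k _ => a k))).
exact: cvg_cst.
Qed.

(** In an ultrapower of N by an ultrafilter finer than the filter of approximate
    realisations, the class of the identity function is an actual realisation. *)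
Lemma realise_type (M N : model T) n (a : 'I_n -> M) (b : 'I_n -> N) (x : M) :
  tp a = tp b -> exists (N' : model T) (h : N -> N'),
    elementary_embedding h /\ exists y : N', tp (tcons y (h \o b)) = tp (tcons x a).
Proof.
move=> ab; have [F PF Fx] := type_approximation x ab.
have [U [UU FU]] := ultraFilterLemma PF; have PU := @ultra_proper _ _ UU.
have [N' [pi piE]] := ultraproduct_of_models (fun _ : N => N) UU.
exists N', (fun z => pi (fun=> z)); split; first exact: ultrapower_diagonal UU piE.
exists (pi id); apply/tpP => phi.
have := piE _ phi (tcons id (fun k _ => b k)).
rewrite comp_tcons => lim_phi; apply: (cvg_real_unique PU lim_phi).
have -> : (fun i : N => feval phi ((tcons id (fun k _ => b k))^~ i)) =
          (fun i => feval phi (tcons i b)).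
  apply/funext => i; congr feval.
  by apply: tcons_ext => [|k]; rewrite (tcons0, tconsS).
exact: cvg_trans (cvg_app _ FU) (Fx phi).
Qed.

Variable rho : preradius T.
Arguments rho n _ : clear implicits.
Hypothesis rhoR : is_radius rho.

Lemma radius_comp (M N : model T) n m (f : 'I_n -> 'I_m) (a : 'I_m -> M)
    (b : 'I_m -> N) :
  rho m (tp a, tp b) -> rho n (tp (a \o f), tp (b \o f)).
Proof.
move=> /(rhoR.2)[M' [N' [g [a' [gP a'E b'E]]]]].
have [_ -> ] := gP _ (a' \o f).
by rewrite (tp_comp f a'E) (_ : g \o _ = (g \o a') \o f)// (tp_comp f b'E).
Qed.

(** A radius is witnessed by maps, and maps preserve equalities. *)
Lemma radius_dist0 (M N : model T) n (a : 'I_n -> M) (b : 'I_n -> N) i j :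
  rho n (tp a, tp b) -> mdist (a i) (a j) = 0 -> b i = b j.
Proof.
move=> /(rhoR.2)[M' [N' [g [a' [gP a'E b'E]]]]] aij.
have a'ij : a' i = a' j by apply: mdist_positivity; rewrite (tp_dist i j a'E).
by apply: mdist_positivity; rewrite -(tp_dist i j b'E) /= a'ij mdistxx.
Qed.

(** The radius provides a map g between models, with g a0 of the type of b.  The
    images under g of approximate realisations of the type of x over a0 converge in
    an ultrapower, and closedness of rho relates the limit to the type of x.  This
    limit type over g a0 is then realised over b. *)
Lemma radius_extend_step (M N : model T) n (a : 'I_n -> M) (b : 'I_n -> N) (x : M) :
  rho n (tp a, tp b) -> exists (N' : model T) (h : N -> N'),
    elementary_embedding h /\
    exists y : N', rho n.+1 (tp (tcons x a), tp (tcons y (h \o b))).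
Proof.
move=> /(rhoR.2)[M0 [N0 [g [a0 [gP a0E b0E]]]]].
have [F PF Fx] := type_approximation x (esym a0E).
have [U [UU FU]] := ultraFilterLemma PF; have PU := @ultra_proper _ _ UU.
have [N1 [pi piE]] := ultraproduct_of_models (fun _ : M0 => N0) UU.
pose h z := pi (fun=> z).
have hE : elementary_embedding h by exact: ultrapower_diagonal UU piE.
have rho1 : rho n.+1 (tp (tcons x a), tp (tcons (pi g) (h \o (g \o a0)))).
  apply: (@preradius_limit _ _ _ rho _ U (fun=> M0) (fun=> N0) _ _ _
    (fun i => tcons i a0) (fun i => g \o tcons i a0) _ _ rhoR.1 PU).
  - by move=> phi; exact: cvg_trans (cvg_app _ FU) (Fx phi).
  - move=> phi; have := piE _ phi (tcons g (fun k _ => g (a0 k))).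
    rewrite comp_tcons.
    have -> // : (fun i => feval phi ((tcons g (fun k _ => g (a0 k)))^~ i)) =
          (fun i => feval phi (g \o tcons i a0)).
    apply/funext => i; congr feval; rewrite comp_tcons.
    by apply: tcons_ext => [|k]; rewrite (tcons0, tconsS).
  - by move=> i; have [_ ->] := gP _ (tcons i a0).
have [|N2 [k [kE [y yE]]]] := @realise_type N1 N _ (h \o (g \o a0)) b (pi g).
  by rewrite (tp_elementary _ hE).
by exists N2, k; split => //; exists y; rewrite yE.
Qed.

Lemma radius_extend_tuple (M N : model T) m n (c : 'I_m -> M) (a : 'I_n -> M)
    (b : 'I_n -> N) :
  rho n (tp a, tp b) -> exists (N' : model T) (h : N -> N'),
    elementary_embedding h /\
    exists d : 'I_m -> N', rho (m + n) (tp (tcat c a), tp (tcat d (h \o b))).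
Proof.
move=> rab; elim: m c => [|m IH] c.
  exists N, id; split; first exact: elementary_id.
  by exists (@no_tuple N); rewrite !tcat0.
have [N1 [h [hE [d dE]]]] := IH (c \o lift ord0).
have [N2 [k [kE [y yE]]]] := radius_extend_step (c ord0) dE.
exists N2, (k \o h); split; first exact: elementary_comp.
exists (tcons y (k \o d)).
rewrite (tcons_eta c) !tcons_tcat.
have -> // : tcat (k \o d) (k \o h \o b) = k \o tcat d (h \o b).
by apply/funext => i; rewrite /tcat /=; case: (fintype.split i).
Qed.

(** All of a is adjoined to its part a \o f as if it were new.  The copies of the
    old entries that this creates are equal to them, and [radius_dist0] transfers
    these equalities to the perturbed tuple. *)
Lemma radius_extend (M N : model T) m n (f : 'I_m -> 'I_n) (a : 'I_n -> M)
    (b : 'I_m -> N) :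
  rho m (tp (a \o f), tp b) -> exists (N' : model T) (h : N -> N'),
    elementary_embedding h /\
    exists d : 'I_n -> N', d \o f = h \o b /\ rho n (tp a, tp d).
Proof.
move=> /(radius_extend_tuple a)[N' [h [hE [d dE]]]].
exists N', h; split => //; exists d; split.
  apply/funext => j /=.
  rewrite -[d _](tcat_lshift d (h \o b)) -[h _](tcat_rshift d (h \o b)).
  by apply: radius_dist0 dE _; rewrite tcat_lshift tcat_rshift mdistxx.
by have := radius_comp (@lshift n m) dE; rewrite !tcat_comp_lshift.
Qed.

Lemma ultraproduct_dist (I : Type) (M : I -> model T) (N : model T) (U : set_system I)
    (pi : (forall i, M i) -> N) :
  (forall n (phi : formula L n) (x : 'I_n -> forall i, M i),
    (fun i => feval phi (x^~ i : 'I_n -> M i)) @ U --> feval phi (pi \o x)) ->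
  forall x y, (fun i => mdist (x i) (y i)) @ U --> mdist (pi x) (pi y).
Proof.
move=> piE x y.
have := piE _ (FDist (TVar L ord0) (TVar L (lift ord0 ord0))) (tcons x (fun=> y) : 'I_2 -> _).
by rewrite /= !tcons0 !tconsS.
Qed.

(** If no g were suitable, counterexamples for g tending to 0 would have as
    ultraproduct a pair of equal points related to a pair of distinct points, against
    [radius_dist0]. *)
Lemma radius_modulus (d : R) : 0 < d -> exists2 g : R, 0 < g &
  forall (M N : model T) n (a : 'I_n -> M) (b : 'I_n -> N) i j,
    rho n (tp a, tp b) -> mdist (a i) (a j) <= g -> mdist (b i) (b j) <= d.
Proof.
move=> d0; apply: contrapT => /forall2NP H.
have /choice[z zP] : forall k : nat,
    exists z : {M : model T & {N : model T & (('I_2 -> M) * ('I_2 -> N))%type}},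
    let a := (projT2 (projT2 z)).1 in let b := (projT2 (projT2 z)).2 in
    [/\ rho 2 (tp a, tp b), mdist (a ord0) (a (lift ord0 ord0)) <= harmonic k &
        d < mdist (b ord0) (b (lift ord0 ord0))].
  move=> k; have [|] := H (harmonic k); first by rewrite harmonic_gt0.
  move=> /existsNP[M /existsNP[N /existsNP[n /existsNP[a /existsNP[b]]]]].
  move=> /existsNP[i /existsNP[j /not_implyP[rab /not_implyP[aij /negP]]]].
  rewrite -ltNge => bij; pose f : 'I_2 -> 'I_n := tcons i (fun=> j).
  exists (existT _ M (existT _ N (a \o f, b \o f))) => /=.
  by rewrite /f !tcons0 !tconsS; split => //; exact: radius_comp.
have [U UU ooU] := ultra_nat; have PU := @ultra_proper _ _ UU.
have [M [piM MP]] := ultraproduct_of_models (fun k => projT1 (z k)) UU.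
have [N [piN NP]] := ultraproduct_of_models (fun k => projT1 (projT2 (z k))) UU.
pose a j k := (projT2 (projT2 (z k))).1 j.
pose b j k := (projT2 (projT2 (z k))).2 j.
have rab : rho 2 (tp (piM \o a), tp (piN \o b)).
  apply: (@preradius_limit _ _ _ rho _ U _ _ _ _ _
    (fun i => a^~ i) (fun i => b^~ i) _ _ rhoR.1 PU).
  - by move=> phi; exact: MP.
  - by move=> phi; exact: NP.
  - by move=> k; have [] := zP k.
have : piN (b ord0) = piN (b (lift ord0 ord0)).
  apply: (@radius_dist0 _ _ _ _ _ ord0 (lift ord0 ord0) rab) => /=.
  apply/eqP; rewrite eq_le mdist_ge0 andbT.
  apply: (le_cvg_filter PU (ultraproduct_dist MP (x := _) (y := _)) (cvg_trans (cvg_app _ ooU) cvg_harmonic)).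
  by apply: nearW => k; have [] := zP k.
move=> bE; have : d <= mdist (piN (b ord0)) (piN (b (lift ord0 ord0))).
  apply: (cvgr_to_ge (ultraproduct_dist NP (x := _) (y := _))).
  by apply: nearW => k; have [_ _ /ltW] := zP k.
by rewrite bE mdistxx leNgt d0.
Qed.

End Radii.

(** * Uniform continuity of formulas *)

Section Continuity.
Variables (R : realType) (L : language R) (T : theory L).

(** Otherwise an ultraproduct of counterexamples would contain two equal tuples at
    which phi takes different values. *)
Lemma feval_uniformly_continuous n (phi : formula L n) (e : R) : 0 < e ->
  exists2 d : R, 0 < d & forall (M : model T) (a b : 'I_n -> M),
    (forall i, mdist (a i) (b i) <= d) -> `|feval phi a - feval phi b| <= e.
Proof.
move=> e0; apply: contrapT => /forall2NP H.
have /choice[z zP] : forall k : nat,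
    exists z : {M : model T & (('I_n -> M) * ('I_n -> M))%type},
    let a := (projT2 z).1 in let b := (projT2 z).2 in
    (forall i, mdist (a i) (b i) <= harmonic k) /\ e < `|feval phi a - feval phi b|.
  move=> k; have [|] := H (harmonic k); first by rewrite harmonic_gt0.
  move=> /existsNP[M /existsNP[a /existsNP[b /not_implyP[ab /negP]]]].
  by rewrite -ltNge => abe; exists (existT _ M (a, b)).
have [U UU ooU] := ultra_nat; have PU := @ultra_proper _ _ UU.
have [M [pi piE]] := ultraproduct_of_models (fun k => projT1 (z k)) UU.
pose a j k := (projT2 (z k)).1 j.
pose b j k := (projT2 (z k)).2 j.
have abE : pi \o a = pi \o b.
  apply/funext => i /=; apply: mdist_positivity.
  apply/eqP; rewrite eq_le mdist_ge0 andbT.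
  apply: (le_cvg_filter PU (ultraproduct_dist piE (x := _) (y := _)) (cvg_trans (cvg_app _ ooU) cvg_harmonic)).
  by apply: nearW => k; have [abk _] := zP k; exact: abk.
have : e <= `|feval phi (pi \o a) - feval phi (pi \o b)|.
  apply: (cvgr_to_ge (cvg_norm (cvgB (piE _ phi a) (piE _ phi b)))).
  by apply: nearW => k; have [_ /ltW] := zP k.
by rewrite abE subrr normr0 leNgt e0.
Qed.

(** Only asymptotically equal tuples are compared, but the models may vary, so
    uniformity in the model is essential. *)
Lemma feval_cvg_transfer (I : Type) (F : set_system I) (M : I -> model T) n
    (a b : forall i, 'I_n -> M i) (phi : formula L n) (c : R) :
  Filter F -> (forall k e, 0 < e -> \forall i \near F, mdist (a i k) (b i k) <= e) ->
  (fun i => feval phi (a i)) @ F --> c -> (fun i => feval phi (b i)) @ F --> c.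
Proof.
move=> FF ab ac; apply/cvgrPdist_le => e e0.
have e2 : 0 < e / 2 by rewrite divr_gt0.
have [d d0 dP] := feval_uniformly_continuous phi e2.
have abd : \forall i \near F, forall k, mdist (a i k) (b i k) <= d.
  by apply: filter_forall => k; exact: ab.
have /cvgrPdist_le /(_ _ e2) aceF := ac.
near=> i.
rewrite (le_trans (ler_distD (feval phi (a i)) _ _))// [leRHS]splitr lerD//.
  by near: i.
by apply: dP; near: i.
Unshelve. all: by end_near. Qed.

End Continuity.

(** * Perturbations up to a small error *)

Section ApproximateRelation.
Variables (R : realType) (L : language R) (T : theory L).
Variable p : perturbation_system T.

Lemma pert_radius e : 0 <= e -> is_radius (p e).
Proof. by have [H _ _ _ _] := pert_atP p; exact: H. Qed.

Lemma pert_refl e n (r : types T n) : 0 <= e -> p e n (r, r).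
Proof. by move=> e0; have [H _] := pert_radius e0; have [_] := H n. Qed.

Lemma pert_sym e n (r s : types T n) : 0 <= e -> p e n (r, s) -> p e n (s, r).
Proof. by have [_ _ H _ _] := pert_atP p; move=> e0; exact: H. Qed.

Lemma pert_trans e e' n (r s t : types T n) : 0 <= e -> 0 <= e' ->
  p e n (r, s) -> p e' n (s, t) -> p (e + e') n (r, t).
Proof.
have [_ _ _ H _] := pert_atP p; move=> e0 e'0 rs st.
by rewrite addrC; apply: (H e' e e'0 e0 n (r, t)); exists s.
Qed.

Lemma pert_mono e e' n (r s : types T n) : 0 <= e -> e <= e' ->
  p e n (r, s) -> p e' n (r, s).
Proof.
move=> e0 ee' rs; rewrite -(subrK e e') addrC.
by apply: (pert_trans e0 _ rs); rewrite ?subr_ge0//; apply: pert_refl; rewrite subr_ge0.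
Qed.

(** Saturation controls a type only up to a perturbation and its realisation only up
    to a distance; e and d measure these two defects. *)
Definition near_pert (M N : model T) n (a : 'I_n -> M) (b : 'I_n -> N) (e d : R) :=
  exists (N' : model T) (h : N -> N') (b' : 'I_n -> N'),
    [/\ elementary_embedding h, forall i, mdist (h (b i)) (b' i) <= d &
        p e n (tp a, tp b')].

Lemma near_pert_tp (M M' N : model T) n (a : 'I_n -> M) (a' : 'I_n -> M')
    (b : 'I_n -> N) e d :
  tp a = tp a' -> near_pert a b e d -> near_pert a' b e d.
Proof.
move=> aa' [N' [h [b' [hE hb ab']]]]; exists N', h, b'; split=> //.
by rewrite -aa'.
Qed.

Lemma near_pert_refl (M N : model T) n (a : 'I_n -> M) (b : 'I_n -> N) e d :
  0 <= e -> 0 <= d -> tp a = tp b -> near_pert a b e d.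
Proof.
move=> e0 d0 ab; exists N, id, b; split; first exact: elementary_id.
  by move=> i; rewrite mdistxx.
by rewrite ab; exact: pert_refl.
Qed.

Lemma near_pert_comp (M N : model T) m n (f : 'I_m -> 'I_n) (a : 'I_n -> M)
    (b : 'I_n -> N) e d :
  0 <= e -> near_pert a b e d -> near_pert (a \o f) (b \o f) e d.
Proof.
move=> e0 [N' [h [b' [hE hb ab']]]]; exists N', h, (b' \o f); split=> // [i|].
  exact: hb.
exact: radius_comp (pert_radius e0) _ _ _ _ _ _ _ ab'.
Qed.

Lemma near_pert_mono (M N : model T) n (a : 'I_n -> M) (b : 'I_n -> N) e d e' d' :
  0 <= e -> e <= e' -> d <= d' -> near_pert a b e d -> near_pert a b e' d'.
Proof.
move=> e0 ee' dd' [N' [h [b' [hE hb ab']]]]; exists N', h, b'; split=> // [i|].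
  exact: le_trans (hb i) dd'.
exact: pert_mono ab'.
Qed.

Variable E : R.
Hypothesis E0 : 0 <= E.

(** One modulus serves for all levels up to E. *)
Definition modulus (g d : R) := forall (M N : model T) n (a : 'I_n -> M)
  (b : 'I_n -> N) i j,
  p E n (tp a, tp b) -> mdist (a i) (a j) <= g -> mdist (b i) (b j) <= d.

Lemma modulus_exists d : 0 < d -> exists g, [/\ 0 < g, g <= d & modulus g d].
Proof.
move=> d0; have [g g0 gP] := radius_modulus (pert_radius E0) d0.
exists (Num.min g d); split; first by rewrite lt_min g0.
  by rewrite ge_min lexx orbT.
move=> M N n a b i j ab aij; apply: gP ab _; apply: le_trans aij _.
by rewrite ge_min lexx.
Qed.

(** The perturbation from b' back to a is extended to the tuple (h b, b').  The
    image of h b is then a tuple related to b, and the modulus bounds its distance to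
    a. *)
Lemma near_pert_sym (M N : model T) n (a : 'I_n -> M) (b : 'I_n -> N) e d d' :
  0 <= e -> e <= E -> modulus d d' -> near_pert a b e d -> near_pert b a e d'.
Proof.
move=> e0 eE dd' [N' [h [b' [hE hb /(pert_sym e0) b'a]]]].
rewrite -{1}(tcat_comp_rshift (h \o b) b') in b'a.
have [M' [k [kE [c [ck cP]]]]] := radius_extend (pert_radius e0) b'a.
exists M', k, (c \o @lshift n n); split=> //.
  move=> i; rewrite -[k _](congr1 (@^~ i) ck) /=.
  apply: dd' (pert_mono e0 eE cP) _.
  by rewrite tcat_lshift tcat_rshift metric_sym; exact: hb.
have := radius_comp (pert_radius e0) (@lshift n n) cP.
by rewrite tcat_comp_lshift (tp_elementary _ hE).
Qed.

(** The perturbation from a is extended to the tuple (a, a1); the image of a1 is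
    close to that of a by the modulus. *)
Lemma near_pert_move (M N : model T) n (a a1 : 'I_n -> M) (b : 'I_n -> N) e d g g' :
  0 <= e -> e <= E -> modulus g g' -> (forall i, mdist (a i) (a1 i) <= g) ->
  near_pert a b e d -> near_pert a1 b e (d + g').
Proof.
move=> e0 eE gg' aa1 [N' [h [b' [hE hb ab']]]].
rewrite -{1}(tcat_comp_lshift a a1) in ab'.
have [N'' [k [kE [c [ck cP]]]]] := radius_extend (pert_radius e0) ab'.
exists N'', (k \o h), (c \o @rshift n n); split=> //.
- exact: elementary_comp.
- move=> i; apply: le_trans (metric_triangle _ (k (b' i)) _) _.
  rewrite lerD//; first by rewrite /= elementary_dist.
  rewrite -[k _](congr1 (@^~ i) ck) /=.
  apply: gg' (pert_mono e0 eE cP) _.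
  by rewrite tcat_lshift tcat_rshift.
- have := radius_comp (pert_radius e0) (@rshift n n) cP.
  by rewrite tcat_comp_rshift.
Qed.

Lemma saturated_realise (M N : model T) n (a : 'I_n -> M) (c : 'I_n -> N) (x : N) e :
  approx_aleph0_saturated p M -> tp c = tp a -> 0 < e ->
  exists y : M, near_pert (tcons x c) (tcons y a) e e.
Proof.
move=> satM ca e0; have [|y [M' [h [b' [a' [hE hy ha [_ -> ya']]]]]]] :=
    satM n a (tp (tcons x c)) e _ e0; first by exists N, c, x.
exists y, M', h, (tcons b' a'); split=> // i.
by case: (unliftP ord0 i) => [j ->|->]; rewrite ?tcons0// !tconsS; exact: ha.
Qed.

(** Coordinates are realised one at a time.  The tuple y found for the last
    coordinates of x only approximates them, so the type of the first coordinate
    cannot be realised over y directly.  By symmetry, y is related exactly to a tuple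
    u close to those last coordinates; it is the type of (x ord0, u) that is
    transferred to y and realised, and u is then moved back. *)
Lemma saturated_realise_tuple (M N : model T) m n (a : 'I_n -> M) (c : 'I_n -> N)
    (x : 'I_m -> N) e d :
  approx_aleph0_saturated p M -> tp c = tp a -> 0 < e -> e <= E -> 0 < d ->
  exists y : 'I_m -> M, near_pert (tcat x c) (tcat y a) e d.
Proof.
move=> satM ca; elim: m x e d => [|m IH] x e d e0 eE d0.
  exists (@no_tuple M); rewrite !tcat0.
  by apply: near_pert_refl => //; exact: ltW.
have d2 : 0 < d / 2 by rewrite divr_gt0.
have e2 : 0 < e / 2 by rewrite divr_gt0.
have e2E : e / 2 <= E by lra.
have [g2 [g20 _ g2P]] := modulus_exists d2.
have [g1 [g10 _ g1P]] := modulus_exists g20.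
have [y yP] := IH (x \o lift ord0) _ _ e2 e2E g10.
have [N1 [h1 [u [h1E h1u /(pert_sym (ltW e2)) uP]]]] :=
  near_pert_sym (ltW e2) e2E g1P yP.
have [M2 [h2 [h2E [v vP]]]] :=
  radius_extend_step (pert_radius (ltW e2)) (h1 (x ord0)) uP.
pose e1 := Num.min (e / 2) (d / 2).
have e10 : 0 < e1 by rewrite lt_min e2.
have [z [M3 [h3 [w [h3E h3w wP]]]]] :=
  saturated_realise v satM (tp_elementary (tcat y a) h2E) e10.
have ze1 : e / 2 + e1 <= e by have : e1 <= e / 2; [rewrite ge_min lexx|lra].
have zd1 : e1 <= d / 2 by rewrite ge_min lexx orbT.
have zP : near_pert (tcons (h1 (x ord0)) u) (tcons z (tcat y a)) e (d / 2).
  exists M3, h3, w; split => // [i|]; first exact: le_trans (h3w i) zd1.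
  apply: (pert_mono _ ze1 (pert_trans (ltW e2) (ltW e10) vP wP)).
  by rewrite addr_ge0// ltW.
exists (tcons z y); rewrite [x]tcons_eta !tcons_tcat.
apply: near_pert_tp (tp_elementary _ h1E) _.
rewrite [d]splitr; apply: near_pert_move (ltW e0) eE g2P _ zP => i.
rewrite comp_tcons; case: (unliftP ord0 i) => [j ->|->].
  by rewrite !tconsS metric_sym; exact: h1u.
by rewrite !tcons0 mdistxx ltW.
Qed.

(** The old tuple b is replaced by a realisation in N of b', the tuple to which a
    is exactly related.  Its distance to b is governed by the old error d, through
    the modulus, while the new error d' is arbitrary. *)
Lemma forth (M N : model T) n (a : 'I_n -> M) (b : 'I_n -> N) (x : M) e d e' d' g :
  approx_aleph0_saturated p N -> 0 <= e -> e < e' -> e' <= E -> 0 < d' ->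
  modulus d g -> near_pert a b e d ->
  exists w : 'I_n.+1 -> N, near_pert (tcons x a) w e' d' /\
    forall i, mdist (b i) (w (lift ord0 i)) <= g + d'.
Proof.
move=> satN e0 ee' e'E d'0 dg [N' [h [b' [hE hb ab']]]].
have [N1 [h1 [h1E [y yP]]]] := radius_extend_step (pert_radius e0) x ab'.
have e10 : 0 < e' - e by rewrite subr_gt0.
have e1E : e' - e <= E by lra.
have d2 : 0 < d' / 2 by rewrite divr_gt0.
have [w [N2 [h2 [z [h2E h2z zP]]]]] := saturated_realise_tuple (tcons y (h1 \o b'))
  satN (tp_elementary b (elementary_comp hE h1E)) e10 e1E d2.
exists w; split.
  exists N2, h2, (z \o @lshift n.+1 n); split=> // [i|].
    have := h2z (lshift n i); rewrite tcat_lshift => /le_trans; apply; lra.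
  rewrite -(subrKC e e'); apply: pert_trans e0 (ltW e10) yP _.
  have := radius_comp (pert_radius (ltW e10)) (@lshift n.+1 n) zP.
  by rewrite tcat_comp_lshift.
move=> i; rewrite -(elementary_dist _ _ h2E).
have := h2z (rshift n.+1 i); rewrite tcat_rshift => bz.
have := h2z (lshift n (lift ord0 i)); rewrite tcat_lshift => wz.
have zz : mdist (z (rshift n.+1 i)) (z (lshift n (lift ord0 i))) <= g.
  apply: dg (pert_mono (ltW e10) e1E zP) _.
  by rewrite tcat_lshift tcat_rshift tconsS /= elementary_dist.
have := metric_triangle (h2 (b i)) (z (rshift n.+1 i)) (h2 (w (lift ord0 i))).
have := metric_triangle (z (rshift n.+1 i)) (z (lshift n (lift ord0 i))) (h2 (w (lift ord0 i))).
rewrite metric_sym in wz; lra.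
Qed.

(** Symmetry is applied before and after the second use of [forth], where the two
    models exchange their roles; d2 and d3 are chosen small enough to absorb the
    loss. *)
Lemma back_and_forth (M N : model T) n (a : 'I_n -> M) (b : 'I_n -> N)
    (x : M) (y : N) e d e' d' g :
  approx_aleph0_saturated p M -> approx_aleph0_saturated p N ->
  0 <= e -> e < e' -> e' <= E -> 0 < d' -> 0 < g -> modulus d g ->
  near_pert a b e d ->
  exists (v : 'I_n.+2 -> M) (w : 'I_n.+2 -> N), [/\ near_pert v w e' d',
    forall i, mdist (a i) (v (lift ord0 (lift ord0 i))) <= g *+ 2,
    forall i, mdist (b i) (w (lift ord0 (lift ord0 i))) <= g *+ 2,
    mdist x (v (lift ord0 ord0)) <= g *+ 2 & w ord0 = y].
Proof.
move=> satM satN e0 ee' e'E d'0 g0 dg abP.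
have [d1 [d10 d1g d1P]] := modulus_exists g0.
have [d2 [d20 d2d1 d2P]] := modulus_exists d10.
have g'0 : 0 < Num.min g d' by rewrite lt_min g0.
have [d3 [d30 + d3P]] := modulus_exists g'0.
rewrite le_min => /andP[d3g _].
pose em := (e + e') / 2; have [eem eme'] : e < em /\ em < e' by split; rewrite /em; lra.
have em0 : 0 <= em by lra.
have emE : em <= E by lra.
have [w [wP bw]] := forth x satN e0 eem emE d20 dg abP.
have wP' := near_pert_sym em0 emE d2P wP.
have [v [vP av]] := forth y satM em0 eme' e'E d30 d1P wP'.
exists v, (tcons y w); split; last by rewrite tcons0.
- have e'0 : 0 <= e' by lra.
  apply: near_pert_mono (near_pert_sym e'0 e'E d3P vP) => //.
  by rewrite ge_min lexx orbT.
- move=> i; have := av (lift ord0 i); rewrite tconsS => /le_trans; apply.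
  by rewrite mulr2n lerD2l.
- move=> i; rewrite tconsS; apply: le_trans (bw i) _.
  by rewrite mulr2n lerD2l; lra.
- by have := av ord0; rewrite tcons0 => /le_trans; apply; rewrite mulr2n lerD2l.
Qed.

End ApproximateRelation.

(** * The back-and-forth construction *)

Section Limits.
Variables (R : realType) (L : language R) (T : theory L).
Variable p : perturbation_system T.
Variables (M N : model T).
Hypothesis satM : approx_aleph0_saturated p M.
Hypothesis satN : approx_aleph0_saturated p N.
Hypothesis MN : elementarily_equivalent M N.
Variable E : R.
Hypothesis E0 : 0 < E.

(** The levels increase strictly to E, which leaves room for one more
    perturbation at every stage. *)
Let level n : R := E * (1 - harmonic n).

Let level_ge0 n : 0 <= level n.
Proof. by rewrite mulr_ge0 ?(ltW E0)// subr_ge0 /= invf_le1// ler1n. Qed.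

Let level_lt n : level n < level n.+1.
Proof. by rewrite ltr_pM2l// ltrD2l ltrN2 /= ltf_pV2 ?posrE// ltr_nat. Qed.

Let level_le n : level n <= E.
Proof. by rewrite ler_piMr ?(ltW E0)// gerBl /= invr_ge0. Qed.

Let shrink n : R := 1 / 2 ^+ n.

Let shrink_gt0 n : 0 < shrink n.
Proof. by rewrite divr_gt0// exprn_gt0. Qed.

Let state := ((nat -> M) * (nat -> N))%type.

(** The modulus turns the error d of a stage into the distance by which the next
    stage moves the tuples; this distance has to be summable over n. *)
Let related_stage n (s : state) := exists d, [/\ d <= shrink n, modulus p E d (shrink n) &
  near_pert p (fun i : 'I_(n.*2) => s.1 i) (fun i : 'I_(n.*2) => s.2 i) (level n) d].

Let refines (x : nat -> M) (y : nat -> N) n (s s' : state) :=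
  [/\ forall i, (i < n.*2)%N -> mdist (s.1 i) (s'.1 i) <= shrink n *+ 2,
      forall i, (i < n.*2)%N -> mdist (s.2 i) (s'.2 i) <= shrink n *+ 2,
      mdist (x n) (s'.1 n.*2) <= shrink n *+ 2 & s'.2 n.*2.+1 = y n].

Let extend x y n s : related_stage n s -> exists s', related_stage n.+1 s' /\ refines x y n s s'.
Proof.
move=> [d [_ dP sP]].
have [d' [d'0 d'1 d'P]] := modulus_exists p (ltW E0) (shrink_gt0 n.+1).
have [v [w [vwP av bw xv wy]]] := back_and_forth (ltW E0) (x n) (y n) satM satN (level_ge0 n)
  (level_lt n) (level_le n.+1) d'0 (shrink_gt0 n) dP sP.
exists (new_last v, new_last w); split.
  exists d'; split=> //.
  exact: (near_pert_comp (fun i : 'I_(n.+1.*2) =>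
    inord (if (i < n.*2)%N then i.+2 else (i == n.*2 :> nat))) (level_ge0 n.+1) vwP).
split=> /=.
- by move=> i i_lt; rewrite (new_last_old v (Ordinal i_lt)); exact: (av (Ordinal i_lt)).
- by move=> i i_lt; rewrite (new_last_old w (Ordinal i_lt)); exact: (bw (Ordinal i_lt)).
- by rewrite new_last_fst.
- by rewrite new_last_snd.
Qed.

Lemma back_and_forth_sequence (x : nat -> M) (y : nat -> N) :
  exists s : nat -> state, forall n, related_stage n (s n) /\ refines x y n (s n) (s n.+1).
Proof.
have [m _] := carrier_nonempty M; have [k _] := carrier_nonempty N.
have /choice[F FP] : forall ns : nat * state, exists s',
    related_stage ns.1 ns.2 -> related_stage ns.1.+1 s' /\ refines x y ns.1 ns.2 s'.
  move=> [n s] /=; have [/(extend x y)[s' s'P]|unrelated] := pselect (related_stage n s).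
    by exists s'.
  by exists s.
pose s := fix s n : state :=
  if n is n'.+1 then F (n', s n') else (fun=> m, fun=> k).
have s_related n : related_stage n (s n).
  elim: n => [|n IH]; last by have [] := FP (n, s n) IH.
  have [d [d0 d1 dP]] := modulus_exists p (ltW E0) (shrink_gt0 0).
  exists d; split=> //; apply: near_pert_refl => //; first exact: ltW.
  apply/tpP => phi.
  by rewrite [LHS](congr1 _ (no_tuple_unique _)) [RHS](congr1 _ (no_tuple_unique _)); exact: MN.
by exists s => n; split=> //; have [] := FP (n, s n) (s_related n).
Qed.

(** A coordinate added at stage n is moved by at most the tail of a geometric series
    afterwards, hence the limits inherit density from the sequences x and y, whose
    terms recur.  The limit tuples are related because p(E) is closed. *)
Lemma related_dense_sequences : separable M -> separable N ->
  exists (al : nat -> M) (be : nat -> N),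
  [/\ forall x e, 0 < e -> exists i, mdist (al i) x < e,
      forall y e, 0 < e -> exists i, mdist (be i) y < e &
      forall n (f : 'I_n -> nat), p E n (tp (al \o f), tp (be \o f))].
Proof.
move=> /dense_sequence[x xP] /dense_sequence[y yP].
have [s sP] := back_and_forth_sequence x y.
(* q n is the sum of the displacements 2 / 2 ^ k allowed at the stages k >= n. *)
pose q n : R := 4 / 2 ^+ n.
have q0 : q @ \oo --> 0 by exact: half_pow_cvg.
have q_ge0 n : 0 <= q n by rewrite divr_ge0// exprn_ge0.
have qE n : shrink n *+ 2 = q n - q n.+1.
  have : (2 : R) ^+ n != 0 by rewrite expf_neq0.
  by rewrite /q /shrink exprS mulr2n => ?; field.
(* From stage i./2.+1 on, the tuples have a coordinate i. *)
have lt_half i n : (i./2.+1 <= n)%N -> (i < n.*2)%N.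
  by rewrite -[X in (X < _)%N]odd_double_half; case: (odd i) => /=; lia.
have /choice[al alP] : forall i, exists l, forall n, (i./2.+1 <= n)%N ->
    mdist ((s n).1 i) l <= q n.
  move=> i; apply: telescoping_limit => // n /lt_half i_lt.
  by rewrite -qE; have [_ [+ _ _ _]] := sP n; exact.
have /choice[be beP] : forall i, exists l, forall n, (i./2.+1 <= n)%N ->
    mdist ((s n).2 i) l <= q n.
  move=> i; apply: telescoping_limit => // n /lt_half i_lt.
  by rewrite -qE; have [_ [_ + _ _]] := sP n; exact.
have q_small e : 0 < e -> exists K, forall n, (K <= n)%N -> q n < e.
  move=> e0; have /cvgrPdist_lt/(_ e e0)[K _ KP] := q0.
  exists K => n /KP /=; rewrite sub0r normrN ger0_norm//.
have xal n : mdist (x n) (al n.*2) <= q n.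
  have [_ [_ _ xs _]] := sP n; have := alP n.*2 n.+1.
  rewrite doubleK => /(_ (leqnn _)); have := metric_triangle (x n) ((s n.+1).1 n.*2) (al n.*2).
  have := qE n; lra.
have ybe n : mdist (y n) (be n.*2.+1) <= q n.
  have [_ [_ _ _ ys]] := sP n; have := beP n.*2.+1 n.+1.
  rewrite /= uphalf_double ys => /(_ (leqnn _)).
  have := qE n; have := shrink_gt0 n; rewrite mulr2n; lra.
exists al, be; split.
- move=> z e e0; have e2 : 0 < e / 2 by rewrite divr_gt0.
  have [K KP] := q_small _ e2; have [n /KP qn xz] := xP z _ K e2.
  exists n.*2; have := metric_triangle (al n.*2) (x n) z.
  by have := xal n; rewrite (metric_sym (x n) (al _)); lra.
- move=> z e e0; have e2 : 0 < e / 2 by rewrite divr_gt0.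
  have [K KP] := q_small _ e2; have [n /KP qn xz] := yP z _ K e2.
  exists n.*2.+1; have := metric_triangle (be n.*2.+1) (y n) z.
  by have := ybe n; rewrite (metric_sym (y n) (be _)); lra.
(* From stage K on, the tuples have all the coordinates f j. *)
move=> n f; pose K := (\max_(j < n) f j).+1.
have fK i j : (f j < (i + K).*2)%N.
  have : (f j <= \max_(j < n) f j)%N by exact: leq_bigmax.
  by rewrite /K; lia.
have fK' i j : ((f j)./2.+1 <= i + K)%N.
  have : (f j <= \max_(j < n) f j)%N by exact: leq_bigmax.
  by rewrite /K; lia.
have /choice[w wP] : forall i, exists w : {N' : model T & ((N -> N') * ('I_n -> N'))%type},
    let h := (projT2 w).1 in let b := (projT2 w).2 in
    [/\ elementary_embedding h,
        forall j, mdist (h ((s (i + K)%N).2 (f j))) (b j) <= shrink (i + K) &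
        p E n (tp ((s (i + K)%N).1 \o f), tp b)].
  move=> i; have [[d [ds _ nP]] _] := sP (i + K)%N.
  have [N' [h [b [hE hb bP]]]] := near_pert_comp
    (fun j : 'I_n => Ordinal (fK i j)) (level_ge0 _) nP.
  exists (existT _ N' (h, b)); split=> //= [j|]; first exact: le_trans (hb j) ds.
  exact: pert_mono (level_ge0 _) (level_le _) bP.
have PR := pert_radius p (ltW E0).
apply: (@preradius_limit _ _ _ (p E) _ \oo (fun=> M) (fun i => projT1 (w i)) _ _ _
    (fun i => (s (i + K)%N).1 \o f) (fun i => (projT2 (w i)).2) _ _ PR.1 _).
- move=> phi; apply: (@feval_cvg_transfer _ _ T _ \oo (fun=> M) _ (fun=> al \o f)).
    move=> j e /q_small[K' K'P]; exists K' => // i /= K'i.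
    apply: le_trans (ltW (K'P (i + K)%N _)); last by lia.
    by rewrite metric_sym; exact: alP.
  exact: cvg_cst.
- move=> phi; apply: (@feval_cvg_transfer _ _ T _ \oo (fun i => projT1 (w i)) _
    (fun i => (projT2 (w i)).1 \o (be \o f))).
    move=> j e e0; have e2 : 0 < e / 2 by rewrite divr_gt0.
    have [K' K'P] := q_small _ e2; exists K' => // i /= K'i.
    have [hE hb _] := wP i.
    have Ki : (K' <= i + K)%N by lia.
    apply: le_trans (metric_triangle _ ((projT2 (w i)).1 ((s (i + K)%N).2 (f j))) _) _.
    rewrite elementary_dist//; have := hb j; have := beP _ _ (fK' i j).
    rewrite (metric_sym (be _)); have := K'P _ Ki; have := qE (i + K)%N.
    have := q_ge0 (i + K).+1; have := shrink_gt0 (i + K)%N; rewrite mulr2n; lra.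
  under eq_fun => i do [have [hE _ _] := wP i; rewrite hE].
  exact: cvg_cst.
- by move=> i; have [] := wP i.
Qed.

End Limits.

(** * From dense sequences to models *)

(** The graph of the continuous extension of al i |-> be i, in a form symmetric in
    the two sequences, so that the inverse map needs no separate treatment. *)
Definition graph_closure (R : realType) (M N : metricType R)
    (al : nat -> M) (be : nat -> N) (x : M) (y : N) : Prop :=
  forall e, 0 < e -> exists i, mdist (al i) x <= e /\ mdist (be i) y <= e.

Lemma graph_closure_sym (R : realType) (M N : metricType R) (al : nat -> M)
    (be : nat -> N) x y :
  graph_closure al be x y -> graph_closure be al y x.
Proof. by move=> xy e /xy[i []]; exists i. Qed.

Section GraphClosure.
Variables (R : realType) (L : language R) (T : theory L).
Variable rho : preradius T.
Arguments rho n _ : clear implicits.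
Hypothesis rhoR : is_radius rho.
Variables (M N : model T) (al : nat -> M) (be : nat -> N).
Hypothesis al_be : forall n (f : 'I_n -> nat), rho n (tp (al \o f), tp (be \o f)).

Lemma sequence_modulus d : 0 < d -> exists2 g, 0 < g &
  forall i j, mdist (al i) (al j) <= g -> mdist (be i) (be j) <= d.
Proof.
move=> /(radius_modulus rhoR)[g g0 gP]; exists g => // i j.
have := gP _ _ _ _ _ ord0 (lift ord0 ord0) (al_be (tcons i (fun=> j) : 'I_2 -> nat)).
by rewrite /= tcons0 tconsS.
Qed.

Lemma graph_closure_functional x y y' :
  graph_closure al be x y -> graph_closure al be x y' -> y = y'.
Proof.
move=> xy xy'; apply: mdist_positivity; apply/eqP.
rewrite eq_le mdist_ge0 andbT; apply/ler_addgt0Pr => e e0; rewrite add0r.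
have e3 : 0 < e / 3 by rewrite divr_gt0.
have [g g0 gP] := sequence_modulus e3.
have r0 : 0 < Num.min (g / 2) (e / 3) by rewrite lt_min e3 divr_gt0.
have [i []] := xy _ r0; have [j []] := xy' _ r0.
rewrite !le_min => /andP[jx _] /andP[_ jy'] /andP[ix _] /andP[_ iy].
have ij : mdist (be i) (be j) <= e / 3.
  apply: gP; have := metric_triangle (al i) x (al j).
  by rewrite (metric_sym x (al j)); lra.
have := metric_triangle y (be i) y'; have := metric_triangle (be i) (be j) y'.
by rewrite (metric_sym y (be i)); lra.
Qed.

Lemma graph_closure_total x :
  (forall x e, 0 < e -> exists i, mdist (al i) x < e) ->
  exists y, graph_closure al be x y.
Proof.
move=> al_dense.
have /choice[u uP] : forall n, exists i, mdist (al i) x < harmonic n.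
  by move=> n; apply: al_dense; exact: harmonic_gt0.
have [|y uy] := @carrier_complete _ _ N ((be \o u) @ \oo) _.
  apply/cauchyP => r r0; have r2 : 0 < r / 2 by rewrite divr_gt0.
  have [g g0 gP] := sequence_modulus r2.
  have [K KP] := harmonic_small (divr_gt0 g0 (ltr0Sn R 1)).
  exists (be (u K)); exists K => // n /= Kn; rewrite ballEmdist /=.
  apply: (@le_lt_trans _ _ (r / 2)); last by rewrite ltr_pdivrMr// ltr_pMr// ltr1n.
  apply: gP; have := metric_triangle (al (u K)) x (al (u n)).
  rewrite (metric_sym x); have := uP K; have := uP n.
  by have := KP _ (leqnn K); have := KP _ Kn; lra.
exists y => e e0; have [K KP] := harmonic_small e0.
have [K' _ K'P] := metricType_numDomainType.cvgr_dist_lt uy e0.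
exists (u (maxn K K')); split.
  exact: ltW (lt_trans (uP _) (KP _ (leq_maxl _ _))).
by rewrite metric_sym; apply: ltW; apply: K'P; exact: leq_maxr.
Qed.

Lemma graph_closure_pert (F : M -> N) :
  (forall x, graph_closure al be x (F x)) -> Pert rho M N F.
Proof.
move=> FP n a; exists (tp a) => //.
have /choice[f fP] : forall k, exists f : 'I_n -> nat, forall j,
    mdist (al (f j)) (a j) <= harmonic k /\ mdist (be (f j)) (F (a j)) <= harmonic k.
  move=> k; have /choice[f fP] j := FP (a j) (harmonic k) (harmonic_gt0 k).
  by exists f.
apply: (@preradius_limit _ _ _ rho _ \oo (fun=> M) (fun=> N) _ _ _
  (fun k => al \o f k) (fun k => be \o f k) _ _ rhoR.1 _).
- move=> phi; apply: (@feval_cvg_transfer _ _ T _ \oo (fun=> M) _ (fun=> a)).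
    move=> j e /harmonic_small[K KP]; exists K => // k /= Kk.
    rewrite metric_sym; have [+ _] := fP k j; move=> /le_trans; apply.
    exact: ltW (KP _ Kk).
  exact: cvg_cst.
- move=> phi; apply: (@feval_cvg_transfer _ _ T _ \oo (fun=> N) _ (fun=> F \o a)).
    move=> j e /harmonic_small[K KP]; exists K => // k /= Kk.
    rewrite metric_sym; have [_] := fP k j; move=> /le_trans; apply.
    exact: ltW (KP _ Kk).
  exact: cvg_cst.
- by move=> k.
Qed.

End GraphClosure.

Theorem proposition2p7 (R : realType) (L : language R) (T : theory L)
    (p : perturbation_system T) (M N : model T) :
  elementarily_equivalent M N ->
  separable M -> separable N ->
  approx_aleph0_saturated p M -> approx_aleph0_saturated p N ->
  pert_isomorphic p M N.
Proof.
move=> MN sepM sepN satM satN e e0.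
have [al [be [al_dense be_dense al_be]]] :=
  related_dense_sequences satM satN MN e0 sepM sepN.
have rhoR := pert_radius p (ltW e0).
have be_al n (f : 'I_n -> nat) : p e n (tp (be \o f), tp (al \o f)).
  exact: pert_sym (ltW e0) (al_be n f).
have /choice[F FP] x := graph_closure_total rhoR al_be x al_dense.
have /choice[G GP] y := graph_closure_total rhoR be_al y be_dense.
exists F; split; first exact: graph_closure_pert FP.
exists G; split; last exact: graph_closure_pert GP.
- move=> x; have := graph_closure_sym (FP x).
  exact: (graph_closure_functional rhoR be_al) (GP (F x)).
- move=> y; have := graph_closure_sym (GP y).
  exact: (graph_closure_functional rhoR al_be) (FP (G y)).
Qed.
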